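(* There is an absolute constant $c>0$ such that the following holds. Let $D$, $\mu$, $F$, $G$ and $(V_n)_{n=1}^\infty$ satisfy Assumption B (see context). For $k\in\mathbb{N}$ let $$\alpha_k:=\sup_{f\in F}\inf_{g\in V_k}\|f-g\|_2,\qquad \Lambda_k:=\sup_{f\in V_k,\ f\ne0}\frac{\|f\|_G}{\|f\|_2}.$$ Then, for every $m\in\mathbb{N}$, there are $n\le cm$, points $x_1,\dots,x_n\in D$ and functions $\varphi_1,\dots,\varphi_n\in V_m$ such that the linear algorithm $A_m\colon F\to V_m$, $A_mf=\sum_{i=1}^n f(x_i)\varphi_i$, satisfies $$\sup_{f\in F}\|f-A_mf\|_2\le\frac{70}{\sqrt m}\sum_{k>\lfloor m/4\rfloor}\frac{\alpha_k}{\sqrt k},$$ and any such algorithm $A_m$ also satisfies $$\sup_{f\in F}\|f-A_mf\|_G\;\le\;2\sum_{k>\lfloor m/4\rfloor}\frac{\alpha_k\,\Lambda_{4k}}{k}\;+\;\frac{70\,\Lambda_m}{\sqrt m}\sum_{k>\lfloor m/4\rfloor}\frac{\alpha_k}{\sqrt k}.$$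
   Context: For a measure $\mu$ on $D$, $L_2=L_2(\mu)$ is the space of complex-valued square-integrable functions with $\|f\|_2=(\int_D|f|^2\,d\mu)^{1/2}$. Assumption B: (B.1) $F$ is a separable metric space of complex-valued functions on a set $D$ such that function evaluation $f\mapsto f(x)$ is, for each $x\in D$, continuous on $F$. (B.2) $\mu$ is a measure on $D$ and $F$ is continuously embedded into $L_2(\mu)$. (B.3) $G$ is a seminormed space of complex-valued functions on $D$ which contains $F$, and $G\cap L_2$ is complete with respect to the natural seminorm $\|\cdot\|_*:=\|\cdot\|_G+\|\cdot\|_2$. If two functions from $G$ are equal $\mu$-almost everywhere, then their seminorm in $G$ is the same. (B.4) $(V_n)_{n=1}^\infty$ is a nested sequence of subspaces of $G\cap L_2$ of dimension $\dim V_n=n$ for $n\in\mathbb{N}$. Right-hand sides may be $+\infty$, in which case the bounds are void. *)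

(* Defs.v *)
From HB Require Import structures.
From mathcomp Require Import all_boot all_order all_algebra.
From mathcomp Require Import complex.
From mathcomp Require Import all_classical all_reals all_analysis.
Import Order.TTheory GRing.Theory Num.Theory numFieldNormedType.Exports.

Set Implicit Arguments.
Unset Strict Implicit.
Unset Printing Implicit Defensive.

Local Open Scope classical_set_scope.
Local Open Scope ring_scope.

Section Defs.
Context {R : realType}.

Section FunctionSpaces.
Context {D : Type}.
Implicit Types (f g : D -> R[i]) (W : set (D -> R[i])).

Definition fsub f g : D -> R[i] := fun x => f x - g x.

Definition is_subspace W : Prop :=
  [/\ W (fun=> 0),
      (forall f g, W f -> W g -> W (fun x => f x + g x))
    & (forall (a : R[i]) f, W f -> W (fun x => a * f x))].

(* Dimension as a space of functions, not of almost-everywhere classes. *)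
Definition has_dim W (n : nat) : Prop :=
  exists b : 'I_n -> D -> R[i],
    (forall c : 'I_n -> R[i],
        (forall x, \sum_(i < n) c i * b i x = 0) -> forall i, c i = 0) /\
    W = [set f | exists c : 'I_n -> R[i],
                   f = (fun x => \sum_(i < n) c i * b i x)].

(* nG is a seminorm on the space G; its values outside G are irrelevant. *)
Record is_seminormed (G : set (D -> R[i])) (nG : (D -> R[i]) -> R) : Prop := {
  seminormed_subspace : is_subspace G;
  seminorm_ge0 : forall f, G f -> 0 <= nG f;
  seminormD : forall f g, G f -> G g -> nG (fun x => f x + g x) <= nG f + nG g;
  seminormZ : forall (a : R[i]) f, G f ->
    nG (fun x => a * f x) = ComplexField.Normc.normc a * nG f }.

End FunctionSpaces.

Section L2.
Context {d : measure_display} {D : measurableType d}.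
Variable mu : {measure set D -> \bar R}.
Implicit Types (f g : D -> R[i]).

Definition norm2 f : \bar R :=
  ('N[mu]_2%:E[EFin \o (fun x => ComplexField.Normc.normc (f x))])%E.

(* Functions, not classes; measurability of the real and imaginary parts is
   measurability for the Borel sigma-algebra of the complex plane. *)
Definition inL2 f : Prop :=
  [/\ measurable_fun [set: D] (fun x => complex.Re (f x)),
      measurable_fun [set: D] (fun x => complex.Im (f x))
    & (norm2 f < +oo)%E].

Definition norm_star (nG : (D -> R[i]) -> R) f : \bar R :=
  ((nG f)%:E + norm2 f)%E.

Definition star_complete (G : set (D -> R[i])) (nG : (D -> R[i]) -> R) : Prop :=
  forall u : nat -> D -> R[i],
    (forall n, G (u n) /\ inL2 (u n)) ->
    (forall e : R, 0 < e -> exists N : nat, forall p q : nat,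
        (N <= p)%N -> (N <= q)%N ->
        (norm_star nG (fsub (u p) (u q)) < e%:E)%E) ->
    exists g, [/\ G g, inL2 g
      & norm_star nG (fsub (u n) g) @[n --> \oo] --> 0%E].

(* F is a metric space of functions: ev f is the function D -> R[i] that the
   point f of F is. V 0 is never used. *)
Record assumptionB (F : metricType R) (ev : F -> D -> R[i])
    (G : set (D -> R[i])) (nG : (D -> R[i]) -> R)
    (V : nat -> set (D -> R[i])) : Prop := {
  B1_functions : injective ev;
  B1_separable : exists A : set F, countable A /\ dense A;
  B1_eval : forall x : D, continuous (fun f : F => (ev f x : R[i]^o));
  B2_L2 : forall f : F, inL2 (ev f);
  B2_continuous : forall f0 : F,
    norm2 (fsub (ev f) (ev f0)) @[f --> f0] --> 0%E;
  B3_seminormed : is_seminormed G nG;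
  B3_contains : forall f : F, G (ev f);
  B3_complete : star_complete G nG;
  B3_ae : forall f g, G f -> G g -> {ae mu, forall x, f x = g x} ->
    nG f = nG g;
  B4_sub : forall n : nat, (0 < n)%N -> forall f, V n f -> G f /\ inL2 f;
  B4_nested : forall n : nat, (0 < n)%N -> V n `<=` V n.+1;
  B4_dim : forall n : nat, (0 < n)%N -> has_dim (V n) n }.

Definition alpha (F : metricType R) (ev : F -> D -> R[i])
    (V : nat -> set (D -> R[i])) (k : nat) : \bar R :=
  ereal_sup [set ereal_inf [set norm2 (fsub (ev f) g) | g in V k]
            | f in [set: F]].

(* If f <> 0 vanishes almost everywhere then, under assumptionB, nG f = 0 and
   the quotient is 0 / 0 = 0, which does not affect the supremum. *)
Definition Lambda (nG : (D -> R[i]) -> R) (V : nat -> set (D -> R[i]))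
    (k : nat) : \bar R :=
  ereal_sup [set (nG f / fine (norm2 f))%:E
            | f in [set f | V k f /\ f <> (fun=> 0)]].

End L2.

(* Product with 0 * +oo = +oo (mathcomp's mule has 0 * +oo = 0): a bound with
   an infinite factor is void. *)
Definition mulev (x y : \bar R) : \bar R :=
  if (x == +oo%E) || (y == +oo%E) then +oo%E else (x * y)%E.

Definition sampling_algorithm (D : Type) (n : nat) (x : 'I_n -> D)
    (phi : 'I_n -> D -> R[i]) (f : D -> R[i]) : D -> R[i] :=
  fun y => \sum_(i < n) f (x i) * phi i y.

End Defs.

(* Main.v *)
(* Let P_l be the orthogonal projection onto the space spanned by V_(2^l m), let
   a_l = alpha_(2^l m) and S = sum_l 2^(l/2) a_l, so that S is at most
   2 / sqrt m * sum_(k > m/4) alpha_k / sqrt k.  The part of f - P_0 f between P_l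
   and P_(l+1) has norm at most a_l.  Giving the l-th block of an orthonormal basis
   the weight t_l ~ a_l / (S 2^(l/2)), the coefficients c of f - P_0 f satisfy
   sum_k |c_k|^2 / t_k <= S^2, while the sum of all the weights is O(m).  The
   barrier method of Batson, Spielman and Srivastava, with the upper potential
   tr (u D - A)^-1 for D = diag (1 / t_k), whose inverse has trace O(m), chooses 5m
   points and weights w for which sum_i w_i |g(x_i)|^2 is at least m |g|^2 on V_m and at
   most O(m) sum_k |c_k|^2 / t_k on the complement: no logarithm is lost and the
   solution of the Kadison-Singer problem is not needed.  The algorithm is weighted
   least squares at these points; values at the points are reached through
   almost everywhere convergence on a countable dense subset of F.

   For the seminorm of G, f - P_0 f is the sum of its blocks by completeness, and
   each block lies in V_(2^(l+1) m), hence costs at most Lambda_(2^(l+1) m) a_l. *)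

Require Import Defs.
From HB Require Import structures.
From mathcomp Require Import all_boot all_order all_algebra.
From mathcomp Require Import complex.
From mathcomp Require Import all_classical all_reals all_analysis.
From mathcomp Require Import measurable_realfun ring lra zify.
Import Order.TTheory GRing.Theory Num.Theory numFieldNormedType.Exports.

Set Implicit Arguments.
Unset Strict Implicit.
Unset Printing Implicit Defensive.

Local Open Scope classical_set_scope.
Local Open Scope ring_scope.

(** * Positive semidefinite complex matrices *)

Section RealPart.
Context {R : rcfType}.
Local Notation C := R[i].
Local Notation Re := (@complex.Re R).
Local Notation Im := (@complex.Im R).
Local Notation rc := (real_complex R).

(** The complement of [V_m] is infinite-dimensional. For a barrier u I - A the trace of the inverse
    would grow with the number of coordinates; with D in place of I it is governed by the sum of the
    weights, whatever that number is. Matrices are finite, however, so the coordinates past a far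
    index, whose weights sum to at most 1/8, are charged directly to the choice of each point.

    Points come from averaging: for an orthonormal system, the integral over x of a quadratic form
    evaluated at the vector of values at x is the trace of the form. A strict inequality between
    traces thus yields a point at which both barriers can move, and a null set can be avoided in
    that choice. This matters because the projections of [f] converge to [f] only off a null set
    depending on [f]; separability leaves countably many such sets.

    Constants: splitting off the far coordinates turns the 128 of the upper barrier into 256,
    passing to the limit gives 512, the error is at most (1 + 23) S since 23^2 >= 512, and S carries
    a factor 2: 48 <= 70. *)

Lemma reD (x y : C) : Re (x + y) = Re x + Re y.
Proof. by case: x y => [a b] [c d]. Qed.

Lemma imD (x y : C) : Im (x + y) = Im x + Im y.
Proof. by case: x y => [a b] [c d]. Qed.

Lemma reN (x : C) : Re (- x) = - Re x.
Proof. by case: x. Qed.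

Lemma imN (x : C) : Im (- x) = - Im x.
Proof. by case: x. Qed.

Lemma reM (x y : C) : Re (x * y) = Re x * Re y - Im x * Im y.
Proof. by case: x y => [a b] [c d]. Qed.

Lemma imM (x y : C) : Im (x * y) = Re x * Im y + Im x * Re y.
Proof. by case: x y => [a b] [c d]. Qed.

Lemma reZ (a : R) (x : C) : Re (rc a * x) = a * Re x.
Proof. by rewrite reM /= mul0r subr0. Qed.

Lemma Re_conjc (x : C) : Re (conjc x) = Re x.
Proof. by case: x. Qed.

Lemma Im_conjc (x : C) : Im (conjc x) = - Im x.
Proof. by case: x. Qed.

Lemma conjcM (x y : C) : conjc (x * y) = conjc x * conjc y.
Proof. exact: rmorphM. Qed.

Lemma conjc_rc (a : R) : conjc (rc a) = rc a.
Proof. exact: conjc_real. Qed.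

Lemma complex_ext (x y : C) : Re x = Re y -> Im x = Im y -> x = y.
Proof. by case: x y => [a b] [c d] /= -> ->. Qed.

Lemma Re_sum I (s : seq I) (P : pred I) (F : I -> C) :
  Re (\sum_(i <- s | P i) F i) = \sum_(i <- s | P i) Re (F i).
Proof. by apply: (big_morph Re reD). Qed.

Definition sqn (z : C) : R := Re z ^+ 2 + Im z ^+ 2.

Lemma sqn_ge0 z : 0 <= sqn z.
Proof. by rewrite addr_ge0 ?sqr_ge0. Qed.

Lemma sqn0 : sqn 0 = 0.
Proof. by rewrite /sqn /= expr0n addr0. Qed.

Lemma sqn_eq0 z : sqn z = 0 -> z = 0.
Proof.
move=> /eqP; rewrite /sqn paddr_eq0 ?sqr_ge0// !sqrf_eq0 => /andP[/eqP a /eqP b].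
exact: complex_ext.
Qed.

Lemma Re_mulJ (z : C) : Re (z * conjc z) = sqn z.
Proof. by rewrite reM Re_conjc Im_conjc /sqn mulrN opprK -!expr2. Qed.

Lemma Im_mulJ (z : C) : Im (z * conjc z) = 0.
Proof. by rewrite imM Re_conjc Im_conjc; ring. Qed.

Lemma mulJ_sqn (z : C) : z * conjc z = rc (sqn z).
Proof. by apply: complex_ext; rewrite ?Re_mulJ ?Im_mulJ. Qed.

Lemma sqnM (y z : C) : sqn (y * z) = sqn y * sqn z.
Proof. by rewrite /sqn reM imM; ring. Qed.

Lemma sqn_conj (z : C) : sqn (conjc z) = sqn z.
Proof. by rewrite /sqn Re_conjc Im_conjc sqrrN. Qed.

Lemma sqnD (y z : C) : sqn (y + z) = sqn y + 2 * Re (y * conjc z) + sqn z.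
Proof. by rewrite /sqn reM reD imD Re_conjc Im_conjc; ring. Qed.

Lemma sqnN (z : C) : sqn (- z) = sqn z.
Proof. by rewrite /sqn reN imN !sqrrN. Qed.

Lemma sqnB (y z : C) : sqn (y - z) = sqn y - 2 * Re (y * conjc z) + sqn z.
Proof. by rewrite sqnD sqnN rmorphN mulrN reN mulrN. Qed.

Lemma sqn_real (a : R) : sqn (rc a) = a ^+ 2.
Proof. by rewrite /sqn /= expr0n addr0. Qed.

Lemma sqnD_le (y z : C) : sqn (y + z) <= 2 * sqn y + 2 * sqn z.
Proof. have := sqn_ge0 (y - z); rewrite sqnB [sqn (y + z)]sqnD; lra. Qed.

Lemma normc_sqn (z : C) : ComplexField.Normc.normc z = Num.sqrt (sqn z).
Proof. by case: z. Qed.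

Lemma normc_sqr (z : C) : ComplexField.Normc.normc z ^+ 2 = sqn z.
Proof. by rewrite normc_sqn sqr_sqrtr// sqn_ge0. Qed.

End RealPart.

(** * Hermitian forms, traces and the one-step updates of the barriers *)

Section Hermitian.
Context {R : rcfType}.
Local Notation C := R[i].
Local Notation rc := (real_complex R).
Local Notation Re := (@complex.Re R).

Definition adj m n (A : 'M[C]_(m, n)) : 'M[C]_(n, m) := map_mx conjc A^T.

Lemma adjE m n (A : 'M[C]_(m, n)) i j : adj A i j = conjc (A j i).
Proof. by rewrite !mxE. Qed.

Lemma adjK m n (A : 'M[C]_(m, n)) : adj (adj A) = A.
Proof. by apply/matrixP => i j; rewrite !adjE conjcK. Qed.

Lemma adjM m n p (A : 'M[C]_(m, n)) (B : 'M[C]_(n, p)) :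
  adj (A *m B) = adj B *m adj A.
Proof. by rewrite /adj trmx_mul map_mxM. Qed.

Lemma adjD m n (A B : 'M[C]_(m, n)) : adj (A + B) = adj A + adj B.
Proof. by rewrite /adj linearD map_mxD. Qed.

Lemma adjN m n (A : 'M[C]_(m, n)) : adj (- A) = - adj A.
Proof. by rewrite /adj linearN map_mxN. Qed.

Lemma adjZc m n (a : C) (A : 'M[C]_(m, n)) : adj (a *: A) = conjc a *: adj A.
Proof. by apply/matrixP => i j; rewrite !mxE rmorphM. Qed.

Lemma adjZ m n (a : R) (A : 'M[C]_(m, n)) : adj (rc a *: A) = rc a *: adj A.
Proof. by rewrite adjZc; congr (_ *: _); apply: conjc_real. Qed.

Lemma adj1 n : adj (1%:M : 'M[C]_n) = 1%:M.
Proof. by rewrite /adj trmx1 map_mx1. Qed.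

Definition rtr n (A : 'M[C]_n) : R := Re (\tr A).

Lemma rtrD n (A B : 'M[C]_n) : rtr (A + B) = rtr A + rtr B.
Proof. by rewrite /rtr linearD reD. Qed.

Lemma rtrN n (A : 'M[C]_n) : rtr (- A) = - rtr A.
Proof. by rewrite /rtr linearN reN. Qed.

Lemma rtrB n (A B : 'M[C]_n) : rtr (A - B) = rtr A - rtr B.
Proof. by rewrite rtrD rtrN. Qed.

Lemma rtrZ n (a : R) (A : 'M[C]_n) : rtr (rc a *: A) = a * rtr A.
Proof. by rewrite /rtr linearZ/= reZ. Qed.

Lemma rtrZc n (a : C) (A : 'M[C]_n) : rtr (a *: A) = Re (a * \tr A).
Proof. by rewrite /rtr linearZ. Qed.

Lemma rtr_mulC m n (A : 'M[C]_(m, n)) (B : 'M[C]_(n, m)) :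
  rtr (A *m B) = rtr (B *m A).
Proof. by rewrite /rtr mxtrace_mulC. Qed.

Lemma rtr_gram m n (A : 'M[C]_(m, n)) :
  rtr (A *m adj A) = \sum_i \sum_j sqn (A i j).
Proof.
rewrite /rtr /mxtrace Re_sum; apply: eq_bigr => i _.
by rewrite mxE Re_sum; apply: eq_bigr => j _; rewrite adjE Re_mulJ.
Qed.

Lemma rtr_gram_ge0 m n (A : 'M[C]_(m, n)) : 0 <= rtr (A *m adj A).
Proof.
by rewrite rtr_gram; do 2!apply: sumr_ge0 => ? _; apply: sqn_ge0.
Qed.

Lemma rtr_gram_eq0 m n (A : 'M[C]_(m, n)) : rtr (A *m adj A) = 0 -> A = 0.
Proof.
rewrite rtr_gram => /eqP; rewrite psumr_eq0; last first.
  by move=> i _; apply: sumr_ge0 => ? _; apply: sqn_ge0.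
move=> /allP h; apply/matrixP => i j; rewrite mxE.
have := h i (mem_index_enum _); rewrite psumr_eq0; last first.
  by move=> *; apply: sqn_ge0.
by move=> /allP/(_ j (mem_index_enum _))/eqP; apply: sqn_eq0.
Qed.

(** Vectors are rows. The real part of the trace reads a real number off the 1 x 1 complex
    matrix. *)
Definition qf n (A : 'M[C]_n) (v : 'rV[C]_n) : R := rtr (v *m A *m adj v).

Definition psd n (A : 'M[C]_n) : Prop := adj A = A /\ forall v, 0 <= qf A v.

Lemma qfD n (A B : 'M[C]_n) v : qf (A + B) v = qf A v + qf B v.
Proof. by rewrite /qf mulmxDr mulmxDl rtrD. Qed.

Lemma qfN n (A : 'M[C]_n) v : qf (- A) v = - qf A v.
Proof. by rewrite /qf mulmxN mulNmx rtrN. Qed.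

Lemma qfB n (A B : 'M[C]_n) v : qf (A - B) v = qf A v - qf B v.
Proof. by rewrite qfD qfN. Qed.

Lemma qfZ n a (A : 'M[C]_n) v : qf (rc a *: A) v = a * qf A v.
Proof. by rewrite /qf -scalemxAr -scalemxAl rtrZ. Qed.

Lemma qf1_ge0 n v : 0 <= qf (1%:M : 'M[C]_n) v.
Proof. by rewrite /qf mulmx1 rtr_gram_ge0. Qed.

Lemma qf1E n v : qf (1%:M : 'M[C]_n) v = \sum_j sqn (v 0 j).
Proof. by rewrite /qf mulmx1 rtr_gram big_ord1. Qed.

Lemma qf1_eq0 n v : qf (1%:M : 'M[C]_n) v = 0 -> v = 0.
Proof. by rewrite /qf mulmx1; apply: rtr_gram_eq0. Qed.

Lemma psd1 n : psd (1%:M : 'M[C]_n).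
Proof. by split; [exact: adj1 | exact: qf1_ge0]. Qed.

Lemma psdD n (A B : 'M[C]_n) : psd A -> psd B -> psd (A + B).
Proof.
move=> [hA pA] [hB pB]; split; first by rewrite adjD hA hB.
by move=> v; rewrite qfD addr_ge0.
Qed.

Lemma psdZ n a (A : 'M[C]_n) : 0 <= a -> psd A -> psd (rc a *: A).
Proof.
move=> a0 [hA pA]; split; first by rewrite adjZ hA.
by move=> v; rewrite qfZ mulr_ge0.
Qed.

Lemma psd_conj m n (A : 'M[C]_n) (X : 'M[C]_(m, n)) :
  psd A -> psd (X *m A *m adj X).
Proof.
move=> [hA pA]; split; first by rewrite !adjM adjK hA mulmxA.
by move=> v; have := pA (v *m X); rewrite /qf adjM !mulmxA.
Qed.

Lemma psd_sandwich n (A B : 'M[C]_n) : adj B = B -> psd A -> psd (B *m A *m B).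
Proof. by move=> hB /(psd_conj B); rewrite hB. Qed.

Lemma psd_gram n m (X : 'M[C]_(m, n)) : psd (X *m adj X).
Proof. by have := psd_conj X (psd1 n); rewrite mulmx1. Qed.

Lemma psd_diag n (A : 'M[C]_n) i : psd A -> 0 <= Re (A i i).
Proof.
move=> [_ /(_ (row i 1%:M))]; rewrite /qf rowE mulmx1 -rowE /rtr trace_mx11.
rewrite mxE (bigD1 i)//= big1 ?addr0; last first.
  by move=> j ji; rewrite adjE !mxE/= (negbTE ji) conjc0 mulr0.
by rewrite adjE !mxE !eqxx conjc1 mulr1.
Qed.

Lemma psd_rtr n (A : 'M[C]_n) : psd A -> 0 <= rtr A.
Proof.
move=> pA; rewrite /rtr /mxtrace Re_sum.
by apply: sumr_ge0 => i _; apply: psd_diag.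
Qed.

Lemma qf_real n (A : 'M[C]_n) v : adj A = A ->
  (v *m A *m adj v) 0 0 = rc (qf A v).
Proof.
move=> hA; have h : adj (v *m A *m adj v) = v *m A *m adj v.
  by rewrite !adjM adjK hA mulmxA.
rewrite /qf /rtr trace_mx11; apply: complex_ext => //=.
move/matrixP: h => /(_ 0 0); rewrite adjE => /(congr1 (@complex.Im R)).
rewrite Im_conjc; lra.
Qed.

Lemma rtr_mulB n (X Y : 'rV[C]_n) (a b : 'cV[C]_n) c d :
  rtr ((X - c *: Y) *m (a - d *: b)) =
  rtr (X *m a) - Re (d * \tr (X *m b)) - Re (c * \tr (Y *m a))
  + Re (c * d * \tr (Y *m b)).
Proof.
rewrite mulmxBr (mulmxBl X) (mulmxBl X).
rewrite -(scalemxAl c Y a).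
rewrite -(scalemxAl c Y (d *: b)).
rewrite -(scalemxAr d X b).
rewrite -(scalemxAr d Y b).
rewrite !rtrB.
rewrite scalerA.
rewrite !rtrZc; ring.
Qed.

Lemma qf_sub n (A : 'M[C]_n) v e c : adj A = A ->
  qf A (v - c *: e) =
  qf A v - 2 * Re (conjc c * (v *m A *m adj e) 0 0) + sqn c * qf A e.
Proof.
move=> hA; set z := (v *m A *m adj e) 0 0.
have ev : \tr (e *m A *m adj v) = conjc z.
  by rewrite trace_mx11 /z -adjE !adjM adjK hA mulmxA.
have e1 : (v - c *: e) *m A = v *m A - c *: (e *m A).
  by rewrite mulmxBl -(scalemxAl c e A).
have e2 : adj (v - c *: e) = adj v - conjc c *: adj e by rewrite adjD adjN adjZc.
rewrite /qf e1 e2 rtr_mulB ev trace_mx11 -/z [c * conjc c]mulJ_sqn reZ -/(rtr _).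
have -> : complex.Re (c * conjc z) = complex.Re (conjc c * z).
  by rewrite !reM !Re_conjc !Im_conjc; ring.
ring.
Qed.

(* Cauchy-Schwarz for the form [N], summed over the unit vectors. *)
Lemma psd_rtr_bound n (N : 'M[C]_n) v : psd N ->
  qf (N *m N) v <= rtr N * qf N v.
Proof.
move=> pN; have [hN pos] := pN.
have -> : qf (N *m N) v = \sum_i sqn ((v *m N) 0 i).
  by rewrite -qf1E /qf mulmx1 adjM hN !mulmxA.
rewrite /rtr /mxtrace Re_sum mulr_suml; apply: ler_sum => i _.
set z := (v *m N) 0 i; set a := Re (N i i).
have a0 : 0 <= a by exact: psd_diag.
have Nii : N i i = rc a.
  move/matrixP: hN => /(_ i i); rewrite adjE => /(congr1 (@complex.Im R)).
  rewrite Im_conjc => h; apply: complex_ext; rewrite //=; lra.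
pose e : 'rV[C]_n := delta_mx 0 i.
have ve : (v *m N *m adj e) 0 0 = z.
  rewrite mxE (bigD1 i)//= big1 ?addr0; last first.
    by move=> j ji; rewrite adjE !mxE/= (negbTE ji) conjc0 mulr0.
  by rewrite adjE [e _ _]mxE !eqxx conjc1 mulr1.
have ev : (e *m N *m adj v) 0 0 = conjc z.
  by rewrite -ve -adjE !adjM adjK hN mulmxA.
have ee : (e *m N *m adj e) 0 0 = rc a.
  rewrite mxE (bigD1 i)//= big1 ?addr0; last first.
    by move=> j ji; rewrite adjE !mxE/= (negbTE ji) conjc0 mulr0.
  by rewrite adjE -rowE !mxE !eqxx conjc1 mulr1.
have key t : 0 <= qf N v - 2 * t * sqn z + t ^+ 2 * sqn z * a.
  have := pos (v - (rc t * z) *: e); rewrite qf_sub// ve /qf /rtr !trace_mx11 ee.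
  have -> : conjc (rc t * z) * z = rc (t * sqn z).
    rewrite conjcM conjc_rc -mulrA [conjc z * z]mulrC mulJ_sqn.
    by rewrite -rmorphM.
  by rewrite sqnM sqn_real /= !mulrA.
(* [key] is tested at its minimiser 1/a. If a = 0 it is affine in t, and a large t forces z = 0. *)
have [a1|a1] := ltP 0 a.
  have := key (a^-1).
  have -> : qf N v - 2 * a^-1 * sqn z + a^-1 ^+ 2 * sqn z * a =
    (a * qf N v - sqn z) / a by field; rewrite gt_eqF.
  by rewrite pmulr_lge0 ?invr_gt0//; lra.
have a00 : a = 0 by lra.
rewrite a00 mul0r; have := sqn_ge0 z; rewrite le_eqVlt => /predU1P[<-//|zp].
have := key ((qf N v + 1) / (2 * sqn z)).
rewrite a00 mulr0 addr0.
have -> : 2 * ((qf N v + 1) / (2 * sqn z)) * sqn z = qf N v + 1 by field; rewrite gt_eqF.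
lra.
Qed.

(** The least eigenvalue of [B] is at least 1 / tr N. This follows from [psd_rtr_bound] at v B,
    without diagonalisation, and is how a bounded trace potential keeps a shifted matrix
    invertible. *)
Lemma qf_inv_bound n (B N : 'M[C]_n) v : B *m N = 1%:M -> psd N ->
  qf 1%:M v <= rtr N * qf B v.
Proof.
move=> BN pN; have NB := mulmx1C BN; have [hN _] := pN.
have hB : adj B = B.
  by rewrite -[LHS]mul1mx -BN -mulmxA -hN -adjM BN adj1 mulmx1.
have := psd_rtr_bound (v *m B) pN.
rewrite /qf adjM hB !mulmxA mulmx1 -(mulmxA v B N) BN mulmx1.
by rewrite -(mulmxA v N B) NB mulmx1.
Qed.

Lemma unitmx_bound n (B : 'M[C]_n) t :
  (forall v, qf 1%:M v <= t * qf B v) -> B \in unitmx.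
Proof.
move=> h; rewrite -row_free_unit; apply/row_freeP.
have : kermx B == 0.
  apply/rowV0P => v /sub_kermxP vB; apply: qf1_eq0.
  apply/eqP; rewrite eq_le qf1_ge0 andbT.
  by have := h v; rewrite {2}/qf vB mul0mx /rtr linear0 /= mulr0.
by rewrite kermx_eq0 => /row_freeP.
Qed.

Lemma psd_inv n (B N : 'M[C]_n) : B *m N = 1%:M -> psd B -> psd N.
Proof.
move=> BN pB; have [hB _] := pB; have NB := mulmx1C BN.
have hN : adj N = N.
  by rewrite -[LHS]mul1mx -NB -mulmxA -hB -adjM NB adj1 mulmx1.
by have := psd_conj N pB; rewrite hN NB mul1mx.
Qed.

Lemma rank1_conj n (A : 'M[C]_n) (q : 'rV[C]_n) : adj A = A ->
  rtr (A *m adj q *m q *m A) = qf (A *m A) q.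
Proof.
by move=> hA; rewrite -(mulmxA _ q A) rtr_mulC /qf !mulmxA.
Qed.

Lemma sherman_morrison n (B M : 'M[C]_n) (q : 'rV[C]_n) (w : R) :
  B *m M = 1%:M -> adj M = M -> 1 - w * qf M q != 0 ->
  (B - rc w *: (adj q *m q)) *m
    (M + rc (w / (1 - w * qf M q)) *: (M *m adj q *m q *m M)) = 1%:M.
Proof.
move=> BM hM ne; set s := qf M q in ne *; set k := w / _.
have qMq : q *m M *m adj q = (rc s)%:M.
  by rewrite [LHS]mx11_scalar qf_real.
rewrite mulmxDr !mulmxBl BM -!scalemxAr -!scalemxAl !mulmxA BM mul1mx.
have -> : adj q *m q *m M *m adj q *m q *m M = rc s *: (adj q *m q *m M).
  transitivity (adj q *m (q *m M *m adj q) *m (q *m M)); first by rewrite !mulmxA.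
  by rewrite qMq mul_mx_scalar -scalemxAl mulmxA.
set X := adj q *m q *m M.
rewrite !scalerA.
have kE : k - k * w * s = w by rewrite /k; field.
rewrite -scalerBl -!rmorphM -rmorphB /=.
have -> : rc (k - k * w * s) = rc w by rewrite kE.
by rewrite subrK.
Qed.

(** By the resolvent identity N - M = dl N D M, with N >= M and D >= 1/th, the trace drops by at
    least (dl / th) tr M^2. This drop is the budget spent by [upper_step]. *)
Lemma upper_shift n (B N D : 'M[C]_n) (dl th : R) :
  B *m N = 1%:M -> psd N -> psd D -> 0 < dl -> 0 < th ->
  (forall v, qf 1%:M v <= th * qf D v) ->
  exists M, [/\ (B + rc dl *: D) *m M = 1%:M, psd M, rtr M <= rtr N &
    dl * rtr (M *m M) <= th * (rtr N - rtr M)].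
Proof.
move=> BN pN pD dl0 th0 hD; have [hN _] := pN; have [aD _] := pD.
have NB := mulmx1C BN.
have pB := psd_inv NB pN; have [aB _] := pB.
have pBD : psd (B + rc dl *: D).
  by apply: psdD; [exact: pB | apply: psdZ; [exact: ltW | exact: pD]].
have uBD : B + rc dl *: D \in unitmx.
  apply: (@unitmx_bound _ _ (rtr N)) => v; apply: le_trans (qf_inv_bound v BN pN) _.
  apply: ler_wpM2l; first exact: psd_rtr.
  rewrite qfD qfZ lerDl; apply: mulr_ge0; first exact: ltW.
  by have [_ ->] := pD.
set M := invmx (B + rc dl *: D).
have BM : (B + rc dl *: D) *m M = 1%:M by rewrite mulmxV.
have MB : M *m (B + rc dl *: D) = 1%:M by rewrite mulVmx.
clearbody M.
have pM := psd_inv BM pBD; have [aM _] := pM.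
have NM : N - M = rc dl *: (N *m D *m M).
  have : N *m ((B + rc dl *: D) - B) *m M = N - M.
    by rewrite mulmxBr NB mulmxBl mul1mx -mulmxA BM mulmx1.
  by move=> <-; rewrite addrC addKr -scalemxAr -scalemxAl.
have MN : N - M = rc dl *: (M *m D *m N).
  have : M *m ((B + rc dl *: D) - B) *m N = N - M.
    by rewrite mulmxBr MB mulmxBl mul1mx -mulmxA BN mulmx1.
  by move=> <-; rewrite addrC addKr -scalemxAr -scalemxAl.
have MDM : th^-1 * rtr (M *m M) <= rtr (M *m D *m M).
  have pDt : psd (D - rc th^-1 *: 1%:M).
    split; first by rewrite adjD adjN adjZ aD adj1.
    move=> v; rewrite qfB qfZ; have := hD v.
    by rewrite -ler_pdivrMl// subr_ge0.
  have := psd_rtr (psd_sandwich aM pDt).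
  by rewrite mulmxBr mulmxBl rtrB -scalemxAr -scalemxAl mulmx1 rtrZ subr_ge0.
(* Substituting N = M + dl M D N on the left leaves the remainder (M D) N adj(M D), which is
   positive. *)
have NDM : rtr (N *m D *m M) >= rtr (M *m D *m M).
  have -> : N *m D *m M = M *m D *m M + rc dl *: (M *m D *m N *m D *m M).
    transitivity ((M + rc dl *: (M *m D *m N)) *m D *m M).
      by rewrite -MN addrC subrK.
    by rewrite !mulmxDl -!scalemxAl.
  rewrite rtrD rtrZ lerDl; apply: mulr_ge0; first exact: ltW.
  apply: psd_rtr; have -> : M *m D *m N *m D *m M = (M *m D) *m N *m adj (M *m D).
    by rewrite adjM aM aD !mulmxA.
  exact: psd_conj.
have MM0 : 0 <= rtr (M *m M) by have := rtr_gram_ge0 M; rewrite aM.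
have e : rtr N - rtr M = dl * rtr (N *m D *m M) by rewrite -rtrB NM rtrZ.
have h0 : 0 <= th^-1 * rtr (M *m M) by rewrite mulr_ge0// invr_ge0 ltW.
have NDM0 : th^-1 * rtr (M *m M) <= rtr (N *m D *m M) := le_trans MDM NDM.
exists M; split; [exact: BM | exact: pM | |].
  rewrite -subr_ge0 e; apply: mulr_ge0; first exact: ltW.
  exact: le_trans NDM0.
by rewrite e mulrCA ler_pM2l// -ler_pdivrMl.
Qed.

(** By Sherman-Morrison the update raises the trace by w qf(M^2) / (1 - w qf(M)). The condition on
    [w] says that this is less than the drop won by the shift. *)
Lemma upper_step n (B N D M : 'M[C]_n) (dl th w : R) (q : 'rV[C]_n) :
  (B + rc dl *: D) *m M = 1%:M -> psd M -> rtr M <= rtr N -> 0 < dl ->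
  dl * rtr (M *m M) <= th * (rtr N - rtr M) -> 0 <= w ->
  w * (qf M q + qf (M *m M) q / (rtr N - rtr M)) < 1 ->
  exists N', [/\ (B + rc dl *: D - rc w *: (adj q *m q)) *m N' = 1%:M,
    psd N' & rtr N' <= rtr N].
Proof.
move=> BM pM le_MN dl0 bM w0 hw; have [aM posM] := pM.
set s := qf M q in hw *; set m2 := qf (M *m M) q in hw *.
have s0 : 0 <= s by apply: posM.
have m20 : 0 <= m2.
  by rewrite /m2 -{2}aM; have [_ ->] := psd_gram M.
set Dl := rtr N - rtr M in bM hw *.
have Dl0 : 0 <= Dl by rewrite subr_ge0.
have hws : w * s < 1.
  apply: le_lt_trans hw; rewrite ler_wpM2l// lerDl; apply: divr_ge0 => //.
have key : w * m2 <= Dl * (1 - w * s).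
  have [Dp|Dn] := ltP 0 Dl.
    have -> : w * m2 = Dl * (w * (m2 / Dl)) by field; rewrite gt_eqF.
    by rewrite ler_pM2l//; lra.
  (* Division by zero gives 0, so the hypothesis says nothing about [m2] here; but then tr M^2 = 0
     and M vanishes. *)
  have D00 : Dl = 0 by apply/eqP; rewrite eq_le Dn.
  have MM : rtr (M *m adj M) = 0.
    apply/eqP; rewrite eq_le rtr_gram_ge0 andbT aM.
    by move: bM; rewrite D00 mulr0 pmulr_rle0.
  have M0 := rtr_gram_eq0 MM.
  by rewrite D00 mul0r /m2 M0 mul0mx /qf mulmx0 mul0mx /rtr linear0 mulr0.
have k0 : 0 <= w / (1 - w * s) by apply: divr_ge0 => //; lra.
exists (M + rc (w / (1 - w * s)) *: (M *m adj q *m q *m M)); split.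
- by apply: sherman_morrison => //; rewrite -/s; apply/eqP; lra.
- apply: psdD => //; apply: psdZ => //.
  have -> : M *m adj q *m q *m M = (M *m adj q) *m adj (M *m adj q).
    by rewrite adjM adjK aM !mulmxA.
  exact: psd_gram.
- rewrite rtrD rtrZ rank1_conj// -/m2 addrC -lerBrDr -/Dl mulrAC.
  by rewrite ler_pdivrMr//; lra.
Qed.

(** 2 dl tr N <= 1 gives B >= 2 dl, so B - dl >= dl remains invertible. The trace at most doubles,
    which a potential of 1/4 can afford, and tr M^2 is at least its rise divided by dl. *)
Lemma lower_shift n (B N : 'M[C]_n) (dl : R) :
  B *m N = 1%:M -> psd N -> 0 < dl -> 2 * dl * rtr N <= 1 -> (0 < n)%N ->
  exists M, [/\ (B - rc dl *: 1%:M) *m M = 1%:M, psd M, rtr M <= 2 * rtr N,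
    rtr N < rtr M & rtr M - rtr N <= dl * rtr (M *m M)].
Proof.
(* Serves to prove dl M <= 1, with x, y, z the values at v of the forms 1, M and M^2. *)
have aux x y z : 0 <= x - 2 * dl * y + dl ^+ 2 * z -> dl * (dl * z) <= dl * y ->
  0 <= x - dl * y by lra.
move=> BN pN dl0 hN n0; have [aN _] := pN; have NB := mulmx1C BN.
have pB := psd_inv NB pN; have [aB _] := pB.
have hB v : 2 * dl * qf 1%:M v <= qf B v.
  have h1 := qf_inv_bound v BN pN.
  have [_ /(_ v) b0] := pB.
  have : 2 * dl * qf 1%:M v <= 2 * dl * (rtr N * qf B v) by rewrite ler_wpM2l//; lra.
  have : 2 * dl * rtr N * qf B v <= 1 * qf B v by rewrite ler_wpM2r.
  lra.
set Bd := B - rc dl *: 1%:M.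
have hBd v : dl * qf 1%:M v <= qf Bd v by rewrite qfB qfZ; have := hB v; lra.
have pBd : psd Bd.
  split; first by rewrite adjD adjN adjZ aB adj1.
  by move=> v; apply: le_trans (hBd v); rewrite mulr_ge0 ?qf1_ge0// ltW.
have uBd : Bd \in unitmx.
  apply: (@unitmx_bound _ _ dl^-1) => v.
  by rewrite ler_pdivlMl.
set M := invmx Bd.
have BM : Bd *m M = 1%:M by rewrite mulmxV.
have MB : M *m Bd = 1%:M by rewrite mulVmx.
clearbody M.
have pM := psd_inv BM pBd; have [aM posM] := pM.
have MN : M - N = rc dl *: (M *m N).
  have : M *m (B - Bd) *m N = M - N.
    by rewrite mulmxBr MB mulmxBl mul1mx -mulmxA BN mulmx1.
  by move=> <-; rewrite opprB addrC subrK -scalemxAr -scalemxAl mulmx1.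
have NM : M - N = rc dl *: (N *m M).
  have : N *m (B - Bd) *m M = M - N.
    by rewrite mulmxBr NB mulmxBl mul1mx -mulmxA BM mulmx1.
  by move=> <-; rewrite opprB addrC subrK -scalemxAr -scalemxAl mulmx1.
have ED : rtr M - rtr N = dl * rtr (N *m M) by rewrite -rtrB NM rtrZ.
have e1 : rtr (N *m M) = rtr (N *m N) + dl * rtr (N *m M *m N).
  transitivity (rtr (N *m N + N *m (M - N))); first by rewrite mulmxBr addrC subrK.
  by rewrite rtrD MN -scalemxAr rtrZ mulmxA.
have e2 : rtr (M *m M) = rtr (N *m M) + dl * rtr (M *m N *m M).
  transitivity (rtr (M *m N + M *m (M - N))); first by rewrite mulmxBr addrC subrK.
  by rewrite rtrD NM -scalemxAr rtrZ mulmxA [rtr (M *m N)]rtr_mulC.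
have NN0 : 0 < rtr (N *m N).
  rewrite lt_def -{2 4}aN rtr_gram_ge0 andbT; apply/eqP => h.
  have : N = 0 by apply: rtr_gram_eq0.
  move=> N0; move: BN; rewrite N0 mulmx0 => /matrixP/(_ (Ordinal n0) (Ordinal n0)).
  by rewrite !mxE eqxx => /eqP; rewrite eq_sym oner_eq0.
have NMN0 : 0 <= rtr (N *m M *m N) by apply: psd_rtr; apply: psd_sandwich.
have MNM0 : 0 <= rtr (M *m N *m M) by apply: psd_rtr; apply: psd_sandwich.
have pMd : psd (1%:M - rc dl *: M).
  split; first by rewrite adjD adjN adjZ adj1 aM.
  move=> v; rewrite qfB qfZ.
  have h2 : 0 <= qf 1%:M (v - rc dl *: (v *m M)) by apply: qf1_ge0.
  have e : qf 1%:M (v - rc dl *: (v *m M)) =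
      qf 1%:M v - 2 * dl * qf M v + dl ^+ 2 * qf (M *m M) v.
    rewrite /qf !mulmx1 adjD adjN adjZ adjM aM mulmxBr !mulmxBl.
    rewrite -!scalemxAl -!scalemxAr !rtrB !rtrZ !mulmxA. ring.
  have h3 : dl * qf (M *m M) v <= qf M v.
    have := hBd (v *m M); rewrite /qf adjM aM !mulmxA mulmx1.
    by rewrite -(mulmxA v M Bd) MB mulmx1.
  rewrite e in h2; apply: (aux _ _ _ h2).
  by apply: ler_wpM2l; [exact: ltW | exact: h3].
(* The bounds [k1] and [k2] combine to tr M - tr N = dl tr(N M) <= 2 dl tr(N^2) <= tr N. *)
have k1 : dl * rtr (N *m M *m N) <= rtr (N *m N).
  have := psd_rtr (psd_sandwich aN pMd).
  by rewrite mulmxBr mulmxBl rtrB mulmx1 -scalemxAr -scalemxAl rtrZ subr_ge0.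
have k2 : 2 * dl * rtr (N *m N) <= rtr N.
  have pB2 : psd (B - rc (2 * dl) *: 1%:M).
    split; first by rewrite adjD adjN adjZ aB adj1.
    by move=> v; rewrite qfB qfZ subr_ge0.
  have := psd_rtr (psd_sandwich aN pB2).
  by rewrite mulmxBr NB mulmxBl mul1mx rtrB -scalemxAr -scalemxAl mulmx1 rtrZ subr_ge0.
have ldd x : 0 <= x -> 0 <= dl * x by move=> x0; rewrite mulr_ge0// ltW.
exists M; split; [exact: BM | exact: pM | | |].
- have : dl * rtr (N *m M) <= dl * (2 * rtr (N *m N)).
    by apply: ler_wpM2l; [exact: ltW | lra].
  lra.
- rewrite -subr_gt0 ED mulr_gt0//; have := ldd _ NMN0; lra.
- rewrite ED; apply: ler_wpM2l; first exact: ltW.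
  have := ldd _ MNM0; lra.
Qed.

(** The update lowers the trace by w qf(M^2) / (1 + w qf(M)), and [w] is large enough for this to
    undo the rise caused by the shift. *)
Lemma lower_step n (B N M : 'M[C]_n) (dl w : R) (p : 'rV[C]_n) :
  (B - rc dl *: 1%:M) *m M = 1%:M -> psd M -> rtr N < rtr M -> 0 < w ->
  1 <= w * (qf (M *m M) p / (rtr M - rtr N) - qf M p) ->
  exists N', [/\ (B - rc dl *: 1%:M + rc w *: (adj p *m p)) *m N' = 1%:M,
    psd N' & rtr N' <= rtr N].
Proof.
move=> BM pM lt_NM w0 hw; have [aM posM] := pM.
set s := qf M p in hw *; set m2 := qf (M *m M) p in hw *.
have s0 : 0 <= s by apply: posM.
set Dl := rtr M - rtr N in hw *.
have Dl0 : 0 < Dl by rewrite subr_gt0.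
have ws0 : 0 <= w * s by rewrite mulr_ge0// ltW.
have key : Dl * (1 + w * s) <= w * m2.
  have -> : w * m2 = Dl * (w * (m2 / Dl)) by field; rewrite gt_eqF.
  by rewrite ler_pM2l//; lra.
have pC : psd (B - rc dl *: 1%:M + rc w *: (adj p *m p)).
  apply: psdD; first exact: psd_inv (mulmx1C BM) pM.
  apply: psdZ; first exact: ltW.
  by rewrite -{2}(adjK p); apply: psd_gram.
have := @sherman_morrison _ _ M p (- w) BM aM.
rewrite -/s mulNr opprK => /(_ _)/wrap[|]; first by apply/eqP; lra.
have -> : rc (- w) = - rc w by rewrite rmorphN.
rewrite scaleNr opprK; set N' := M + _ => BN'.
exists N'; split; [exact: BN' | exact: psd_inv BN' pC |].
rewrite /N' rtrD rtrZ rank1_conj// -/m2 mulNr mulNr.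
have : Dl <= w / (1 + w * s) * m2 by rewrite mulrAC ler_pdivlMr//; lra.
rewrite /Dl; lra.
Qed.

End Hermitian.

(** * The two-sided barrier argument *)

Section Barrier.
Context {R : rcfType}.
Local Notation C := R[i].
Local Notation rc := (real_complex R).

Lemma qf_rank1 n (p v : 'rV[C]_n) :
  qf (adj p *m p) v = sqn ((v *m adj p) 0 0).
Proof.
have -> : qf (adj p *m p) v = rtr ((v *m adj p) *m adj (v *m adj p)).
  by rewrite /qf adjM adjK !mulmxA.
by rewrite rtr_gram !big_ord1.
Qed.

Lemma qf_gram n T (s : seq (T * R)) (p : T -> 'rV[C]_n) v :
  qf (\sum_(xw <- s) rc xw.2 *: (adj (p xw.1) *m p xw.1)) v =
  \sum_(xw <- s) xw.2 * sqn ((v *m adj (p xw.1)) 0 0).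
Proof.
rewrite (big_morph (fun A => qf A v) (id1 := 0) (op1 := +%R)).
- by apply: eq_bigr => xw _; rewrite qfZ qf_rank1.
- by move=> A B; exact: qfD.
- by rewrite /qf mulmx0 mul0mx /rtr linear0.
Qed.

Variables (X : Type) (good : X -> Prop) (r K m : nat).
Variables (p : X -> 'rV[C]_r) (q : X -> 'rV[C]_K) (tau : X -> R).
Variables (D DI : 'M[C]_K).
Hypotheses (r_gt0 : (0 < r)%N) (le_rm : (r <= m)%N).
Hypothesis tau_ge0 : forall x, 0 <= tau x.
Hypotheses (D_inv : D *m DI = 1%:M) (DI_psd : psd DI).
Hypotheses (DI_tr : rtr DI <= 6 * m%:R)
  (D_ge : forall v, qf 1%:M v <= 2 * qf D v).
Hypothesis select : forall (P : 'M[C]_r) (Q : 'M[C]_K),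
  rtr Q + 8^-1 < rtr P ->
  exists x, good x /\ qf Q (q x) + tau x < qf P (p x).

(* The lower barrier starts at [-4m] and moves by 1 per step, the upper barrier
   starts at [48m D] and moves by [16 D]: at any step the expected cost of the
   upper update is at most 1/4 (and 1/8 for [tau]), the expected gain of the
   lower one at least 1/2. After [5m] steps they are at [m] and [128m D]. *)
Let lowerB (s : seq (X * R)) : 'M[C]_r :=
  rc (4 * m%:R - (size s)%:R) *: 1%:M
  + \sum_(xw <- s) rc xw.2 *: (adj (p xw.1) *m p xw.1).
Let upperB (s : seq (X * R)) : 'M[C]_K :=
  rc (48 * m%:R + 16 * (size s)%:R) *: D
  - \sum_(xw <- s) rc xw.2 *: (adj (q xw.1) *m q xw.1).

Lemma barrier_run k : exists s : seq (X * R), [/\ size s = k,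
  forall xw, List.In xw s -> good xw.1 /\ 0 < xw.2,
  \sum_(xw <- s) xw.2 * tau xw.1 <= k%:R,
  exists N, [/\ lowerB s *m N = 1%:M, psd N & rtr N <= 4^-1] &
  exists N, [/\ upperB s *m N = 1%:M, psd N & rtr N <= 8^-1]].
Proof.
have m0 : 0 < m%:R :> R by rewrite ltr0n (leq_trans r_gt0).
elim: k => [|k [s [sk gs ts [N1 [BN1 pN1 tN1]] [N2 [BN2 pN2 tN2]]]]].
  exists [::]; split=> //; first by rewrite big_nil.
    exists (rc (4 * m%:R)^-1 *: 1%:M); split.
    - rewrite /lowerB big_nil addr0 /= subr0 -scalemxAl mul1mx scalerA -rmorphM/=.
      have -> : 4 * m%:R * (4 * m%:R)^-1 = 1 :> R by rewrite mulfV// gt_eqF//; lra.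
      by rewrite scale1r.
    - by apply: psdZ; [rewrite invr_ge0; lra | exact: psd1].
    - rewrite rtrZ /rtr mxtrace1.
      have -> : complex.Re (r%:R : C) = r%:R.
        by rewrite -[RHS]/(complex.Re (rc r%:R)) rmorph_nat.
      rewrite mulrC ler_pdivrMr; last lra.
      have : r%:R <= m%:R :> R by rewrite ler_nat.
      lra.
  exists (rc (48 * m%:R)^-1 *: DI); split.
  - rewrite /upperB big_nil subr0 /= mulr0 addr0 -scalemxAl -scalemxAr D_inv.
    rewrite scalerA -rmorphM/=.
    have -> : 48 * m%:R * (48 * m%:R)^-1 = 1 :> R by rewrite mulfV// gt_eqF//; lra.
    by rewrite scale1r.
  - by apply: psdZ => //; rewrite invr_ge0; lra.
  - rewrite rtrZ mulrC ler_pdivrMr; have := DI_tr; lra.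
have pD : psd D := psd_inv (mulmx1C D_inv) DI_psd.
have [|M1 [BM1 pM1 tM1 lt1 D1]] := lower_shift BN1 pN1 ltr01 _ r_gt0.
  by lra.
have dl2 : 0 < 16 :> R by lra.
have th2 : 0 < 2 :> R by lra.
have [M2 [BM2 pM2 tM2 D2]] := upper_shift BN2 pN2 pD dl2 th2 D_ge.
set d1 := rtr M1 - rtr N1; set d2 := rtr N2 - rtr M2.
have d1_gt0 : 0 < d1 by rewrite subr_gt0.
have d2_ge0 : 0 <= d2 by rewrite subr_ge0.
(* The conditions of [lower_step] and [upper_step] as quadratic forms in the new vectors, so that
   [select] only has to compare traces. *)
pose P := rc d1^-1 *: (M1 *m M1) - M1.
pose Q := M2 + rc d2^-1 *: (M2 *m M2).
have MM2 : 0 <= rtr (M2 *m M2).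
  by have [aM _] := pM2; have := rtr_gram_ge0 M2; rewrite aM.
have hP : 2^-1 <= rtr P.
  rewrite /P rtrB rtrZ.
  have : 1 <= d1^-1 * rtr (M1 *m M1) by rewrite ler_pdivlMl//; rewrite /d1; lra.
  lra.
have hQ : rtr Q <= 4^-1.
  rewrite /Q rtrD rtrZ.
  have : d2^-1 * rtr (M2 *m M2) <= 8^-1.
    have [d2p|d2n] := ltP 0 d2.
      by rewrite ler_pdivrMl//; rewrite -/d2 in D2; lra.
    have -> : d2 = 0 by lra.
    by rewrite invr0 mul0r; lra.
  lra.
have [|x [gx hx]] := @select P Q; first lra.
set L := qf P (p x) in hx.
have qQ0 : 0 <= qf Q (q x).
  rewrite /Q qfD qfZ addr_ge0//; first by have [_ ->] := pM2.
  apply: mulr_ge0; first by rewrite invr_ge0.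
  by have [aM _] := pM2; have := psd_gram M2; rewrite aM => -[_ ->].
have L0 : 0 < L by have := tau_ge0 x; lra.
(* The smallest weight accepted by [lower_step]. Since L exceeds both the upper cost and [tau x], it
   also satisfies [upper_step], and w tau <= 1. *)
pose w := L^-1.
have w0 : 0 < w by rewrite invr_gt0.
have wL : w * L = 1 by rewrite mulVf// gt_eqF.
have [|N1' [BN1' pN1' tN1']] := lower_step (p := p x) BM1 pM1 lt1 w0.
  have -> : qf (M1 *m M1) (p x) / (rtr M1 - rtr N1) - qf M1 (p x) = L.
    by rewrite /L /P qfB qfZ mulrC.
  by rewrite wL.
have wlt : w * (qf M2 (q x) + qf (M2 *m M2) (q x) / d2) < 1.
  have -> : qf M2 (q x) + qf (M2 *m M2) (q x) / d2 = qf Q (q x).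
    by rewrite /Q qfD qfZ mulrC.
  by rewrite -wL ltr_pM2l//; have := tau_ge0 x; lra.
have [N2' [BN2' pN2' tN2']] := upper_step BM2 pM2 tM2 dl2 D2 (ltW w0) wlt.
exists ((x, w) :: s); split.
- by rewrite /= sk.
- by move=> xw /= [<-//|]; apply: gs.
- rewrite big_cons /= -add1n natrD lerD//.
  by rewrite -wL ler_pM2l//; lra.
- exists N1'; split; [|exact: pN1'|exact: le_trans tN1' tN1].
  rewrite -BN1' /lowerB big_cons /=; congr (_ *m _).
  have -> : rc (4 * m%:R - (size s).+1%:R) = rc (4 * m%:R - (size s)%:R) - rc 1.
    by rewrite -rmorphB /= -[(size s).+1]add1n natrD; congr (rc _); ring.
  by rewrite scalerBl -!addrA; congr (_ + _); rewrite [RHS]addrC -addrA.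
- exists N2'; split; [|exact: pN2'|exact: le_trans tN2' tN2].
  rewrite -BN2' /upperB big_cons /=; congr (_ *m _).
  have -> : rc (48 * m%:R + 16 * (size s).+1%:R) =
      rc (48 * m%:R + 16 * (size s)%:R) + rc 16.
    by rewrite -rmorphD /= -[(size s).+1]add1n natrD; congr (rc _); ring.
  by rewrite scalerDl opprD -!addrA; congr (_ + _); rewrite [RHS]addrC -addrA.
Qed.

Lemma barrier_points : exists s : seq (X * R), [/\ size s = (5 * m)%N,
  forall xw, List.In xw s -> good xw.1 /\ 0 < xw.2,
  \sum_(xw <- s) xw.2 * tau xw.1 <= 5 * m%:R,
  forall v : 'rV[C]_r, m%:R * \sum_j sqn (v 0 j) <=
    \sum_(xw <- s) xw.2 * sqn ((v *m adj (p xw.1)) 0 0) &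
  forall v : 'rV[C]_K, \sum_(xw <- s) xw.2 * sqn ((v *m adj (q xw.1)) 0 0) <=
    128 * m%:R * qf D v].
Proof.
have [s [ss gs ts [N1 [BN1 pN1 _]] [N2 [BN2 pN2 _]]]] := barrier_run (5 * m).
exists s; split => //; first by rewrite -natrM.
- move=> v; have [_ /(_ v)] := psd_inv (mulmx1C BN1) pN1.
  rewrite /= qfD qfZ qf1E qf_gram ss natrM.
  lra.
- move=> v; have [_ /(_ v)] := psd_inv (mulmx1C BN2) pN2.
  rewrite /= qfB qfZ qf_gram ss natrM.
  lra.
Qed.

End Barrier.

(** * Square-integrable complex functions *)

Section L2.
Context {R : realType} {d : measure_display} {D : measurableType d}.
Variable mu : {measure set D -> \bar R}.
Local Notation C := R[i].
Local Notation rc := (real_complex R).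
Local Notation Re := (@complex.Re R).
Local Notation Im := (@complex.Im R).
Implicit Types (f g h : D -> C).

Definition rint (u : D -> R) : R := Rintegral mu setT u.
Definition rintegrable (u : D -> R) : Prop := mu.-integrable setT (EFin \o u).

Lemma rintegrableD u v : rintegrable u -> rintegrable v ->
  rintegrable (fun x => u x + v x).
Proof. by move=> iu iv; apply: (integrableD _ iu iv). Qed.

Lemma rintegrableZ a u : rintegrable u -> rintegrable (fun x => a * u x).
Proof. by move=> iu; apply: (integrableZl _ a iu). Qed.

Lemma rintegrableB u v : rintegrable u -> rintegrable v ->
  rintegrable (fun x => u x - v x).
Proof. by move=> iu iv; apply: (integrableB _ iu iv). Qed.

Lemma rintegrable0 : rintegrable (fun=> 0).
Proof. exact: integrable0. Qed.

Lemma rintD u v : rintegrable u -> rintegrable v ->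
  rint (fun x => u x + v x) = rint u + rint v.
Proof. by move=> iu iv; apply: RintegralD. Qed.

Lemma rintB u v : rintegrable u -> rintegrable v ->
  rint (fun x => u x - v x) = rint u - rint v.
Proof. by move=> iu iv; apply: RintegralB. Qed.

Lemma rintZ a u : rintegrable u -> rint (fun x => a * u x) = a * rint u.
Proof. by move=> iu; apply: RintegralZl. Qed.

Lemma rint0 : rint (fun=> 0) = 0.
Proof. by rewrite /rint /Rintegral integral0. Qed.

Lemma rintegrable_EFin u : rintegrable u ->
  (\int[mu]_x (u x)%:E = (rint u)%:E)%E.
Proof. by move=> iu; rewrite fineK//; apply: integrable_fin_num. Qed.

Definition cmeas f : Prop :=
  measurable_fun setT (fun x => Re (f x)) /\
  measurable_fun setT (fun x => Im (f x)).

Definition int2 f : \bar R := (\int[mu]_x (sqn (f x))%:E)%E.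
(** [fine] turns an infinite value into 0, hence the hypotheses [inL2] wherever [sq2] and [n2] have
    to behave as norms. *)
Definition sq2 f : R := fine (int2 f).
Definition n2 f : R := fine (norm2 mu f).

Lemma int2_ge0 f : (0 <= int2 f)%E.
Proof. by apply: integral_ge0 => x _; rewrite lee_fin sqn_ge0. Qed.

Lemma sq2_ge0 f : 0 <= sq2 f.
Proof. exact/fine_ge0/int2_ge0. Qed.

Lemma measurable_sqn f : cmeas f -> measurable_fun setT (fun x => sqn (f x)).
Proof.
by move=> [mr mi]; apply: measurable_funD; apply: measurable_funX.
Qed.

Lemma norm2E f : norm2 mu f = (int2 f `^ 2^-1)%E.
Proof.
rewrite /norm2 unlock /=; congr (_ `^ _)%E; apply: eq_integral => x _ /=.
rewrite ger0_norm; last by rewrite normc_sqn sqrtr_ge0.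
rewrite powR_mulrn ?normc_sqr// normc_sqn sqrtr_ge0//.
Qed.

Lemma inL2P f : inL2 mu f <-> cmeas f /\ (int2 f < +oo)%E.
Proof.
split=> [[mr mi]|[[mr mi]]].
  rewrite norm2E => h; split => //.
  by apply: lty_poweRy h; rewrite invr_neq0// pnatr_eq0.
move=> h; split => //; rewrite norm2E poweR_lty//.
Qed.

Lemma inL2_int2 f : inL2 mu f -> int2 f = (sq2 f)%:E.
Proof. by move=> /inL2P[_ h]; rewrite fineK// ge0_fin_numE// int2_ge0. Qed.

Lemma inL2_n2 f : inL2 mu f -> n2 f = Num.sqrt (sq2 f).
Proof.
move=> h; rewrite /n2 norm2E inL2_int2//= powR12_sqrt//; exact: sq2_ge0.
Qed.

Lemma inL2_norm2 f : inL2 mu f -> norm2 mu f = (n2 f)%:E.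
Proof.
by move=> h; rewrite inL2_n2// norm2E inL2_int2//= powR12_sqrt ?sq2_ge0.
Qed.

Lemma n2_ge0 f : 0 <= n2 f.
Proof. by apply: fine_ge0; apply: Lnorm_ge0. Qed.

Lemma n2_sqr f : inL2 mu f -> n2 f ^+ 2 = sq2 f.
Proof. by move=> h; rewrite inL2_n2// sqr_sqrtr// sq2_ge0. Qed.

Lemma inL2_rintegrable f : inL2 mu f <-> cmeas f /\ rintegrable (fun x => sqn (f x)).
Proof.
rewrite inL2P; split=> -[mf h]; split => //.
  apply/integrableP; split; first exact/measurable_EFinP/measurable_sqn.
  rewrite (le_lt_trans _ h)//; apply: ge0_le_integral => //=.
  - by apply/measurable_EFinP/measurableT_comp => //; apply: measurable_sqn.
  - exact/measurable_EFinP/measurable_sqn.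
  - by move=> x _; rewrite lee_fin ger0_norm// sqn_ge0.
move/integrableP: h => [_]; apply: le_lt_trans; apply: ge0_le_integral => //=.
- by move=> x _; rewrite lee_fin sqn_ge0.
- exact/measurable_EFinP/measurable_sqn.
- by apply/measurable_EFinP/measurableT_comp => //; apply: measurable_sqn.
- by move=> x _; rewrite lee_fin ger0_norm// sqn_ge0.
Qed.

Lemma sq2E f : sq2 f = rint (fun x => sqn (f x)).
Proof. by []. Qed.

Lemma cmeasD f g : cmeas f -> cmeas g -> cmeas (fun x => f x + g x).
Proof.
move=> [a b] [a' b']; split.
  by under eq_fun do rewrite reD; apply: measurable_funD.
by under eq_fun do rewrite imD; apply: measurable_funD.
Qed.

Lemma cmeasM f g : cmeas f -> cmeas g -> cmeas (fun x => f x * g x).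
Proof.
move=> [a b] [a' b']; split.
  by under eq_fun do rewrite reM; apply: measurable_funB; apply: measurable_funM.
by under eq_fun do rewrite imM; apply: measurable_funD; apply: measurable_funM.
Qed.

Lemma cmeas_conj f : cmeas f -> cmeas (fun x => conjc (f x)).
Proof.
move=> [a b]; split; first by under eq_fun do rewrite Re_conjc.
by under eq_fun do rewrite Im_conjc; apply: measurable_funN.
Qed.

Lemma cmeas_cst (a : C) : cmeas (fun=> a).
Proof. by split; apply: measurable_cst. Qed.

Lemma rintegrable_le (u v : D -> R) : measurable_fun setT u ->
  (forall x, `|u x| <= v x) -> rintegrable v -> rintegrable u.
Proof.
move=> mu' uv; apply: le_integrable => //; first exact/measurable_EFinP.
by move=> x _ /=; rewrite lee_fin (le_trans (uv x))// ler_norm.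
Qed.

Lemma inL2D f g : inL2 mu f -> inL2 mu g -> inL2 mu (fun x => f x + g x).
Proof.
move=> /inL2_rintegrable[mf fi] /inL2_rintegrable[mg gi].
apply/inL2_rintegrable; split; first exact: cmeasD.
apply: (rintegrable_le (v := fun x => 2 * sqn (f x) + 2 * sqn (g x))).
- exact/measurable_sqn/cmeasD.
- by move=> x; rewrite ger0_norm ?sqn_ge0// sqnD_le.
- by apply: rintegrableD; apply: rintegrableZ.
Qed.

Lemma inL2Z a f : inL2 mu f -> inL2 mu (fun x => a * f x).
Proof.
move=> /inL2_rintegrable[mf fi]; apply/inL2_rintegrable; split.
  exact: cmeasM (cmeas_cst a) mf.
by under eq_fun do rewrite sqnM; apply: rintegrableZ.
Qed.

Lemma inL20 : inL2 mu (fun=> 0).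
Proof.
apply/inL2_rintegrable; split; first exact: cmeas_cst.
by under eq_fun do rewrite sqn0; apply: rintegrable0.
Qed.

Lemma inL2B f g : inL2 mu f -> inL2 mu g -> inL2 mu (fsub f g).
Proof.
move=> hf hg; rewrite (_ : fsub f g = fun x => f x + (-1) * g x).
  exact/inL2D/inL2Z.
by apply/funext => x; rewrite /fsub mulN1r.
Qed.

Lemma inL2_sum I (s : seq I) (P : pred I) (F : I -> D -> C) :
  (forall i, P i -> inL2 mu (F i)) ->
  inL2 mu (fun x => \sum_(i <- s | P i) F i x).
Proof.
move=> h; elim: s => [|i s ih]; first by under eq_fun do rewrite big_nil; exact: inL20.
under eq_fun do rewrite big_cons.
by have := h i; case: (P i) => hi //; apply: inL2D => //; apply: hi.
Qed.

Definition cintegrable f : Prop :=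
  rintegrable (fun x => Re (f x)) /\ rintegrable (fun x => Im (f x)).

Definition cint f : C := Complex (rint (fun x => Re (f x))) (rint (fun x => Im (f x))).

Lemma cintegrableD f g : cintegrable f -> cintegrable g ->
  cintegrable (fun x => f x + g x).
Proof.
move=> [a b] [a' b']; split.
  by under eq_fun do rewrite reD; apply: rintegrableD.
by under eq_fun do rewrite imD; apply: rintegrableD.
Qed.

Lemma cintD f g : cintegrable f -> cintegrable g ->
  cint (fun x => f x + g x) = cint f + cint g.
Proof.
move=> [a b] [a' b']; apply: complex_ext; rewrite ?reD ?imD /=.
  by under eq_fun do rewrite reD; rewrite rintD.
by under eq_fun do rewrite imD; rewrite rintD.
Qed.

Lemma cintegrableZ a f : cintegrable f -> cintegrable (fun x => a * f x).
Proof.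
move=> [r i]; split.
  by under eq_fun do rewrite reM; apply: rintegrableB; apply: rintegrableZ.
by under eq_fun do rewrite imM; apply: rintegrableD; apply: rintegrableZ.
Qed.

Lemma cintZ a f : cintegrable f -> cint (fun x => a * f x) = a * cint f.
Proof.
move=> [r i]; apply: complex_ext; rewrite ?reM ?imM /=.
  under eq_fun do rewrite reM.
  by rewrite rintB ?rintZ//; apply: rintegrableZ.
under eq_fun do rewrite imM.
by rewrite rintD ?rintZ//; apply: rintegrableZ.
Qed.

Lemma cintegrable0 : cintegrable (fun=> 0).
Proof. by split; apply: rintegrable0. Qed.

Lemma cint0 : cint (fun=> 0) = 0.
Proof. by apply: complex_ext; rewrite /= rint0. Qed.

Lemma cintegrable_sum I (s : seq I) (F : I -> D -> C) :
  (forall i, cintegrable (F i)) -> cintegrable (fun x => \sum_(i <- s) F i x).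
Proof.
move=> h; elim: s => [|i s ih].
  by under eq_fun do rewrite big_nil; exact: cintegrable0.
by under eq_fun do rewrite big_cons; apply: cintegrableD.
Qed.

Lemma cint_sum I (s : seq I) (F : I -> D -> C) :
  (forall i, cintegrable (F i)) ->
  cint (fun x => \sum_(i <- s) F i x) = \sum_(i <- s) cint (F i).
Proof.
move=> h; elim: s => [|i s ih].
  by under eq_fun do rewrite big_nil; rewrite cint0 big_nil.
under eq_fun do rewrite big_cons.
by rewrite cintD ?big_cons ?ih//; apply: cintegrable_sum.
Qed.

Definition ip f g : C := cint (fun x => f x * conjc (g x)).

Lemma mul_cintegrable f g : inL2 mu f -> inL2 mu g ->
  cintegrable (fun x => f x * conjc (g x)).
Proof.
move=> /inL2_rintegrable[mf fi] /inL2_rintegrable[mg gi].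
have [mR mI] := cmeasM mf (cmeas_conj mg).
have i2 := rintegrableD fi gi.
have amgm (a b c e : R) : `|a * b + c * e| <= a ^+ 2 + c ^+ 2 + (b ^+ 2 + e ^+ 2).
  have := sqr_ge0 (a + b); have := sqr_ge0 (a - b).
  have := sqr_ge0 (c + e); have := sqr_ge0 (c - e).
  by rewrite ler_norml => ? ? ? ?; apply/andP; split; nra.
split; apply: rintegrable_le i2 => // x; rewrite ?reM ?imM Re_conjc Im_conjc.
  by rewrite mulrN opprK; apply: le_trans (amgm _ _ _ _) _.
rewrite mulrN addrC -mulrN; apply: le_trans (amgm _ _ _ _) _.
by rewrite sqrrN /sqn; lra.
Qed.

Lemma ipDl f g h : inL2 mu f -> inL2 mu g -> inL2 mu h ->
  ip (fun x => f x + g x) h = ip f h + ip g h.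
Proof.
move=> hf hg hh; rewrite /ip; under eq_fun do rewrite mulrDl.
by rewrite cintD//; apply: mul_cintegrable.
Qed.

Lemma ipZl a f h : inL2 mu f -> inL2 mu h ->
  ip (fun x => a * f x) h = a * ip f h.
Proof.
move=> hf hh; rewrite /ip; under eq_fun do rewrite -mulrA.
by rewrite cintZ//; apply: mul_cintegrable.
Qed.

Lemma ip_conj f g : inL2 mu f -> inL2 mu g -> ip g f = conjc (ip f g).
Proof.
move=> hf hg; have [iR iI] := mul_cintegrable hf hg.
apply: complex_ext; rewrite ?Re_conjc ?Im_conjc /=.
  by congr rint; apply/funext => x; rewrite !reM !Re_conjc !Im_conjc; ring.
rewrite -mulN1r -rintZ//; congr rint; apply/funext => x.
by rewrite !imM !Re_conjc !Im_conjc; ring.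
Qed.

End L2.

(** * Orthonormal systems and projections for functions rather than classes *)

Section InnerProduct.
Context {R : realType} {d : measure_display} {D : measurableType d}.
Variable mu : {measure set D -> \bar R}.
Local Notation C := R[i].
Local Notation rc := (real_complex R).
Local Notation Re := (@complex.Re R).
Local Notation Im := (@complex.Im R).
Local Notation inL2 := (inL2 mu).
Local Notation ip := (ip mu).
Local Notation sq2 := (sq2 mu).
Local Notation n2 := (n2 mu).
Implicit Types (f g h : D -> C).

Lemma ipff f : inL2 f -> ip f f = rc (sq2 f).
Proof.
move=> hf; apply: complex_ext => /=.
  by rewrite sq2E; congr rint; apply/funext => x; rewrite Re_mulJ.
rewrite -[RHS](rint0 mu); congr rint; apply/funext => x; exact: Im_mulJ.
Qed.

Lemma ip0l h : ip (fun=> 0) h = 0.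
Proof. by rewrite /ip; under eq_fun do rewrite mul0r; rewrite cint0. Qed.

Lemma ip_suml n (F : 'I_n -> D -> C) h :
  (forall i, inL2 (F i)) -> inL2 h ->
  ip (fun x => \sum_(i < n) F i x) h = \sum_(i < n) ip (F i) h.
Proof.
move=> hF hh; rewrite /ip; under eq_fun do rewrite mulr_suml.
rewrite -(@cint_sum _ _ _ mu _ _ (fun i x => F i x * conjc (h x)))// => i.
exact: mul_cintegrable.
Qed.

Lemma sq2D f g : inL2 f -> inL2 g ->
  sq2 (fun x => f x + g x) = sq2 f + 2 * Re (ip f g) + sq2 g.
Proof.
move=> hf hg; have [iR _] := mul_cintegrable hf hg.
have [_ fi] := (inL2_rintegrable mu f).1 hf.
have [_ gi] := (inL2_rintegrable mu g).1 hg.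
rewrite !sq2E; under eq_fun do rewrite sqnD.
rewrite rintD//; first by rewrite rintD ?rintZ//; apply: rintegrableZ.
by apply: rintegrableD => //; apply: rintegrableZ.
Qed.

Lemma sq2Z a f : inL2 f -> sq2 (fun x => a * f x) = sqn a * sq2 f.
Proof.
move=> hf; have [_ fi] := (inL2_rintegrable mu f).1 hf.
by rewrite !sq2E; under eq_fun do rewrite sqnM; rewrite rintZ.
Qed.

Lemma fsubE f g : fsub f g = fun x => f x + (-1) * g x.
Proof. by apply/funext => x; rewrite mulN1r. Qed.

Lemma ipZr a f g : inL2 f -> inL2 g -> ip f (fun x => a * g x) = conjc a * ip f g.
Proof.
move=> hf hg; rewrite ip_conj//; last exact: inL2Z.
by rewrite ipZl// conjcM -ip_conj.
Qed.

Lemma ipBl f g h : inL2 f -> inL2 g -> inL2 h -> ip (fsub f g) h = ip f h - ip g h.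
Proof.
by move=> hf hg hh; rewrite fsubE ipDl ?ipZl ?mulN1r//; apply: inL2Z.
Qed.

Lemma sq2B f g : inL2 f -> inL2 g ->
  sq2 (fsub f g) = sq2 f - 2 * Re (ip f g) + sq2 g.
Proof.
move=> hf hg; rewrite fsubE sq2D//; last exact: inL2Z.
rewrite ipZr// sq2Z// sqnN.
have -> : sqn (1 : C) = 1 by rewrite /sqn /= expr1n expr0n addr0.
by rewrite rmorphN rmorph1 mulN1r reN; ring.
Qed.

Lemma Re_ip_le f g : inL2 f -> inL2 g -> Re (ip f g) <= n2 f * n2 g.
Proof.
move=> hf hg.
have key t : 0 <= sq2 f + 2 * (t * Re (ip f g)) + t ^+ 2 * sq2 g.
  have := sq2_ge0 mu (fun x => f x + rc t * g x).
  by rewrite sq2D ?ipZr ?sq2Z ?sqn_real ?conjc_rc ?reZ//; apply: inL2Z.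
rewrite -(n2_sqr hf) -(n2_sqr hg) in key.
set a := n2 f in key *; set c := n2 g in key *; set b := Re _ in key *.
have a0 : 0 <= a := n2_ge0 mu f.
have : 0 <= c := n2_ge0 mu g; rewrite le_eqVlt => /predU1P[c0|cp].
  rewrite -c0 mulr0; rewrite leNgt; apply/negP => b0.
  have := key (- (a ^+ 2 + 1) / (2 * b)).
  rewrite -c0 expr0n mulr0 addr0.
  have -> : 2 * (- (a ^+ 2 + 1) / (2 * b) * b) = - (a ^+ 2 + 1).
    by field; rewrite gt_eqF.
  lra.
have := key (- a / c).
have -> : (- a / c) ^+ 2 * c ^+ 2 = a ^+ 2 by field; rewrite gt_eqF.
move: a0; rewrite le_eqVlt => /predU1P[a0|ap].
  rewrite -a0 mul0r => _; rewrite leNgt; apply/negP => b0.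
  have := key (- b / c ^+ 2); rewrite -a0 expr0n add0r.
  have -> : 2 * (- b / c ^+ 2 * b) + (- b / c ^+ 2) ^+ 2 * c ^+ 2 = - (b ^+ 2 / c ^+ 2).
    by field; rewrite gt_eqF.
  have : 0 < b ^+ 2 / c ^+ 2 by rewrite divr_gt0 ?exprn_gt0.
  lra.
have -> : a ^+ 2 + 2 * (- a / c * b) + a ^+ 2 = (2 * a / c) * (a * c - b).
  by field; rewrite gt_eqF.
by rewrite pmulr_rge0 ?subr_ge0// divr_gt0// mulr_gt0.
Qed.

Lemma n2D f g : inL2 f -> inL2 g -> n2 (fun x => f x + g x) <= n2 f + n2 g.
Proof.
move=> hf hg; have hfg := inL2D hf hg.
rewrite -(@ler_pXn2r _ 2)// ?nnegrE ?addr_ge0 ?n2_ge0//.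
rewrite n2_sqr// sq2D// -(n2_sqr hf) -(n2_sqr hg).
by have := Re_ip_le hf hg; lra.
Qed.

Lemma n2_subC f g : n2 (fsub f g) = n2 (fsub g f).
Proof.
rewrite /n2 !norm2E; congr (fine (_ `^ _)%E); apply: eq_integral => x _.
by rewrite /fsub -sqnN opprB.
Qed.

Lemma n2_tri f g h : inL2 f -> inL2 g -> inL2 h ->
  n2 (fsub f h) <= n2 (fsub f g) + n2 (fsub g h).
Proof.
move=> hf hg hh; have -> : fsub f h = fun x => fsub f g x + fsub g h x.
  by apply/funext => x; rewrite /fsub addrA subrK.
by apply: n2D; apply: inL2B.
Qed.

Lemma n2_eq0 f : inL2 f -> sq2 f = 0 -> n2 f = 0.
Proof. by move=> hf h; rewrite inL2_n2// h sqrtr0. Qed.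

Lemma sq2_ae0 f : inL2 f -> sq2 f = 0 -> {ae mu, forall x, f x = 0}.
Proof.
move=> hf h0; have [mf _] := (inL2P mu f).1 hf.
have : (\int[mu]_x `|(sqn (f x))%:E| = 0)%E.
  rewrite -[RHS]/(0%:E) -h0 -inL2_int2//; apply: eq_integral => x _.
  by rewrite gee0_abs// lee_fin sqn_ge0.
move=> h; have : ae_eq mu setT (fun x => (sqn (f x))%:E) (cst 0%E).
  apply/(ae_eq_integral_abs _ measurableT) => //.
  exact/measurable_EFinP/measurable_sqn.
apply: filterS => x /(_ I) /= /eqP; rewrite eqe => /eqP; exact: sqn_eq0.
Qed.

Definition onsys (b : nat -> D -> C) n : Prop :=
  (forall i, (i < n)%N -> inL2 (b i)) /\
  (forall i j, (i < n)%N -> (j < n)%N -> ip (b i) (b j) = (i == j)%:R).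

Definition comb (b : nat -> D -> C) n (c : nat -> C) : D -> C :=
  fun x => \sum_(k < n) c k * b k x.

Definition orthproj b n f := comb b n (fun k => ip f (b k)).

Section Orthonormal.
Variables (b : nat -> D -> C) (n : nat).
Hypothesis onb : onsys b n.

Lemma inL2_comb c : inL2 (comb b n c).
Proof. by apply: inL2_sum => i _; apply: inL2Z; apply: onb.1. Qed.

Lemma ip_comb c h : inL2 h ->
  ip (comb b n c) h = \sum_(k < n) c k * ip (b k) h.
Proof.
move=> hh; rewrite ip_suml//; last by move=> i; apply: inL2Z; apply: onb.1.
by apply: eq_bigr => i _; rewrite ipZl//; apply: onb.1.
Qed.

Lemma ip_comb_basis c j : (j < n)%N -> ip (comb b n c) (b j) = c j.
Proof.
move=> jn; rewrite ip_comb; last exact: onb.1.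
rewrite (bigD1 (Ordinal jn))//= onb.2// eqxx mulr1 big1 ?addr0// => i ij.
rewrite onb.2//; case: eqP => [e|]; last by rewrite mulr0.
by move: ij; rewrite -val_eqE /= e eqxx.
Qed.

Lemma sq2_comb c : sq2 (comb b n c) = \sum_(k < n) sqn (c k).
Proof.
have h := inL2_comb c.
rewrite -[LHS]/(Re (rc _)) -ipff// ip_comb// Re_sum; apply: eq_bigr => i _.
by rewrite ip_conj ?ip_comb_basis ?Re_mulJ//; apply: onb.1.
Qed.

Lemma sq2_sub_comb f c : inL2 f -> sq2 (fsub f (comb b n c)) =
  sq2 f - \sum_(k < n) sqn (ip f (b k)) + \sum_(k < n) sqn (ip f (b k) - c k).
Proof.
move=> hf; have h := inL2_comb c.
rewrite sq2B// sq2_comb ip_conj// Re_conjc ip_comb// Re_sum.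
under [X in _ = _ + X]eq_bigr do rewrite sqnB.
rewrite [X in _ = _ + X]big_split [X in _ = _ + (X + _)]big_split/= sumrN.
rewrite -mulr_sumr addrA addrA subrK; congr (_ - 2 * _ + _).
apply: eq_bigr => k _; rewrite (ip_conj hf (onb.1 k (ltn_ord k))).
by rewrite !reM !Re_conjc !Im_conjc; ring.
Qed.

Lemma bessel f : inL2 f ->
  sq2 (fsub f (orthproj b n f)) = sq2 f - \sum_(k < n) sqn (ip f (b k)).
Proof.
move=> hf; rewrite sq2_sub_comb// [X in _ + X]big1 ?addr0// => k _.
by rewrite subrr sqn0.
Qed.

Lemma proj_min f c : inL2 f ->
  n2 (fsub f (orthproj b n f)) <= n2 (fsub f (comb b n c)).
Proof.
move=> hf.
rewrite -(@ler_pXn2r _ 2)// ?nnegrE ?n2_ge0//.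
have hp : inL2 (orthproj b n f) by apply: inL2_comb.
have hc := inL2_comb c.
rewrite !n2_sqr ?bessel ?sq2_sub_comb//; try exact: inL2B.
by rewrite lerDl; apply: sumr_ge0 => k _; apply: sqn_ge0.
Qed.

(** [g] need only agree with its projection up to a null function, which is all that a complete
    system of functions can guarantee. *)
Lemma proj_best f g : inL2 f -> inL2 g -> sq2 (fsub g (orthproj b n g)) = 0 ->
  n2 (fsub f (orthproj b n f)) <= n2 (fsub f g).
Proof.
move=> hf hg h0; have hp : inL2 (orthproj b n g) by apply: inL2_comb.
apply: le_trans (proj_min _ hf) _; apply: le_trans (n2_tri hf hg hp) _.
by rewrite (n2_eq0 _ h0) ?addr0//; apply: inL2B.
Qed.

Lemma ip_sub_proj f k : inL2 f -> (k < n)%N -> ip (fsub f (orthproj b n f)) (b k) = 0.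
Proof.
move=> hf kn; have hp : inL2 (orthproj b n f) by apply: inL2_comb.
by rewrite ipBl ?ip_comb_basis ?subrr//; apply: onb.1.
Qed.

Lemma orthprojB f g : inL2 f -> inL2 g ->
  orthproj b n (fsub f g) = fsub (orthproj b n f) (orthproj b n g).
Proof.
move=> hf hg; apply/funext => x; rewrite /fsub /orthproj /comb -sumrB.
by apply: eq_bigr => k _; rewrite ipBl ?mulrBl//; apply: onb.1.
Qed.

Lemma n2_orthproj f : inL2 f -> n2 (orthproj b n f) <= n2 f.
Proof.
move=> hf; have hp : inL2 (orthproj b n f) by apply: inL2_comb.
rewrite -(@ler_pXn2r _ 2)// ?nnegrE ?n2_ge0// !n2_sqr// sq2_comb.
have := sq2_ge0 mu (fsub f (orthproj b n f)); rewrite bessel//; lra.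
Qed.

Lemma orthproj_sub f j : (j <= n)%N ->
  fsub (orthproj b n f) (orthproj b j f) =
  comb b n (fun k => if (k < j)%N then 0 else ip f (b k)).
Proof.
move=> jn; apply/funext => x.
have combN i (v : nat -> C) : comb b i v x = \sum_(0 <= k < i) v k * b k x.
  by rewrite big_mkord.
rewrite /fsub /orthproj !combN (big_cat_nat (n := j))//=.
rewrite [in RHS](big_cat_nat (n := j))//=.
rewrite [X in _ = X + _]big_nat [X in _ = X + _]big1 ?add0r; last first.
  by move=> k /andP[_ kj]; rewrite kj mul0r.
rewrite [LHS]addrC addKr big_nat [RHS]big_nat; apply: eq_bigr => k /andP[kj _].
by rewrite ltnNge kj.
Qed.

End Orthonormal.

Lemma bessel_tail b n j f : onsys b n -> inL2 f -> (j <= n)%N ->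
  \sum_(j <= k < n) sqn (ip f (b k)) <= sq2 (fsub f (orthproj b j f)).
Proof.
move=> onb hf jn; have onj : onsys b j.
  split=> [i ij|i k ij kj]; first exact: onb.1 _ (leq_trans ij jn).
  exact: onb.2 _ _ (leq_trans ij jn) (leq_trans kj jn).
rewrite (bessel onj)//.
have := sq2_ge0 mu (fsub f (orthproj b n f)).
rewrite (bessel onb)// -!(big_mkord xpredT (fun k => sqn (ip f (b k)))).
by rewrite (big_cat_nat (n := j))//=; lra.
Qed.

Lemma n2_orthproj_sub b n j f : onsys b n -> inL2 f -> (j <= n)%N ->
  n2 (fsub (orthproj b n f) (orthproj b j f)) <= n2 (fsub f (orthproj b j f)).
Proof.
move=> onb hf jn; have onj : onsys b j.
  split=> [i ij|i k ij kj]; first exact: onb.1 _ (leq_trans ij jn).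
  exact: onb.2 _ _ (leq_trans ij jn) (leq_trans kj jn).
have hn : inL2 (orthproj b n f) by apply: inL2_comb.
have hj : inL2 (orthproj b j f) by apply: inL2_comb.
rewrite -(@ler_pXn2r _ 2)// ?nnegrE ?n2_ge0//.
rewrite (n2_sqr (inL2B hn hj)) (n2_sqr (inL2B hf hj)).
apply: le_trans (bessel_tail onb hf jn).
rewrite orthproj_sub// sq2_comb// -(big_mkord xpredT
  (fun k => sqn (if (k < j)%N then 0 else ip f (b k)))).
rewrite (big_cat_nat (n := j))//= big_nat big1 ?add0r; last first.
  by move=> k /andP[_ kj]; rewrite kj sqn0.
by rewrite big_nat [leRHS]big_nat; apply: ler_sum => k /andP[jk _]; rewrite ltnNge jk.
Qed.

Lemma subspace_comb (W : set (D -> C)) b n c : is_subspace W ->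
  (forall k, (k < n)%N -> W (b k)) -> W (comb b n c).
Proof.
move=> [W0 WD WZ]; elim: n => [|n ih] h.
  rewrite (_ : comb b 0 c = fun=> 0)//.
  by apply/funext => x; rewrite /comb big_ord0.
rewrite (_ : comb b n.+1 c = fun x => comb b n c x + c n * b n x); last first.
  by apply/funext => x; rewrite /comb big_ord_recr.
apply: WD; last exact/WZ/h.
by apply: ih => k kn; apply: h; rewrite ltnS ltnW.
Qed.

Lemma has_dim_subspace (W : set (D -> C)) N : has_dim W N -> is_subspace W.
Proof.
move=> [b [_ ->]]; split.
- exists (fun=> 0); apply/funext => x; rewrite big1// => i _; exact: mul0r.
- move=> f g [c ->] [c' ->]; exists (fun i => c i + c' i); apply/funext => x.
  by rewrite -big_split/=; apply: eq_bigr => i _; rewrite mulrDl.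
- move=> a f [c ->]; exists (fun i => a * c i); apply/funext => x.
  by rewrite mulr_sumr; apply: eq_bigr => i _; rewrite mulrA.
Qed.

(** More than N combinations of N functions satisfy a nontrivial linear relation; pairing it with
    each [b j] shows that all its coefficients vanish. *)
Lemma orthonormal_le_dim (W : set (D -> C)) N b n : has_dim W N ->
  onsys b n -> (forall k, (k < n)%N -> W (b k)) -> (n <= N)%N.
Proof.
move=> [beta [_ WE]] onb Wb; rewrite leqNgt; apply/negP => ltNn.
have /choice[c cP] : forall k : 'I_n, exists c : 'I_N -> C,
    b k = fun x => \sum_(i < N) c i * beta i x.
  by move=> k; have := Wb k (ltn_ord k); rewrite WE.
pose A : 'M[C]_(n, N) := \matrix_(k, i) c k i.
have : kermx A != 0.
  rewrite kermx_eq0 /row_free neq_ltn; apply/orP; left.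
  exact: leq_ltn_trans (rank_leq_col A) ltNn.
move=> /rowV0Pn[v /sub_kermxP vA /eqP]; apply.
apply/rowP => j; rewrite mxE.
pose vv k := if insub k is Some i then v 0 (i : 'I_n) else 0.
have vvE (k : 'I_n) : vv k = v 0 k by rewrite /vv valK.
rewrite -vvE -(ip_comb_basis onb)//.
rewrite (_ : comb b n vv = fun=> 0) ?ip0l//.
apply/funext => x; rewrite /comb.
under eq_bigr do rewrite vvE cP mulr_sumr.
rewrite exchange_big big1//= => i _.
have /rowP/(_ i) := vA; rewrite !mxE => e.
transitivity ((\sum_k v 0 k * A k i) * beta i x); last by rewrite e mul0r.
by rewrite mulr_suml; apply: eq_bigr => k _; rewrite mxE mulrA.
Qed.

(** Greedy Gram-Schmidt: while some function of [W] has a nonzero remainder, its normalised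
    remainder is appended. [orthonormal_le_dim] makes this stop. *)
Lemma orthonormal_extend (W : set (D -> C)) N b n : has_dim W N ->
  (forall f, W f -> inL2 f) ->
  onsys b n -> (forall k, (k < n)%N -> W (b k)) ->
  exists b' n', [/\ (n <= n')%N, (forall k, (k < n)%N -> b' k = b k),
    onsys b' n', (forall k, (k < n')%N -> W (b' k)) &
    forall f, W f -> sq2 (fsub f (orthproj b' n' f)) = 0].
Proof.
move=> dW WL2; have sW := has_dim_subspace dW.
have [k] := ubnP (N - n); elim: k b n => // k ih b n Nk onb Wb.
have [h|/existsNP[f /not_implyP[Wf /eqP f0]]] :=
  pselect (forall f, W f -> sq2 (fsub f (orthproj b n f)) = 0).
  by exists b, n.
have hf := WL2 _ Wf.
set g := fsub f (orthproj b n f) in f0.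
have hg : inL2 g by apply: inL2B => //; apply: inL2_comb.
have Wg : W g.
  have [_ WD WZ] := sW; rewrite /g fsubE; apply: WD => //; apply: WZ.
  exact: subspace_comb.
have n2g : n2 g != 0 by apply/eqP => e; move: f0; rewrite -n2_sqr// e expr0n eqxx.
pose e := fun x => rc (n2 g)^-1 * g x.
pose b' j := if j == n then e else b j.
have b'lt j : (j < n)%N -> b' j = b j by move=> jn; rewrite /b' ltn_eqF.
have b'n : b' n = e by rewrite /b' eqxx.
have he : inL2 e by apply: inL2Z.
have We : W e by have [_ _ WZ] := sW; apply: WZ.
have ipe j : (j < n)%N -> ip e (b j) = 0.
  by move=> jn; rewrite ipZl ?ip_sub_proj ?mulr0//; apply: onb.1.
have onb' : onsys b' n.+1.
  split=> [i|i j]; first rewrite ltnS leq_eqVlt => /predU1P[->|lt_in].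
  - by rewrite b'n.
  - by rewrite b'lt//; apply: onb.1.
  rewrite !ltnS leq_eqVlt => /predU1P[->|lt_in].
    rewrite b'n leq_eqVlt => /predU1P[->|lt_jn].
      rewrite b'n eqxx ipff// sq2Z// sqn_real -n2_sqr// exprVn mulVf ?rmorph1//.
      by rewrite expf_neq0.
    by rewrite b'lt// ipe// gtn_eqF.
  rewrite b'lt// leq_eqVlt => /predU1P[->|lt_jn].
    rewrite b'n ip_conj// ?ipe ?rmorph0 ?ltn_eqF//; exact: onb.1.
  by rewrite b'lt// onb.2.
have Wb' j : (j < n.+1)%N -> W (b' j).
  rewrite ltnS leq_eqVlt => /predU1P[->|lt_in]; first by rewrite b'n.
  by rewrite b'lt//; apply: Wb.
have le_nN := orthonormal_le_dim dW onb' Wb'.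
have [|b2 [n' [len' agr onb2 Wb2 cmp]]] := ih b' n.+1 _ onb' Wb'.
  by rewrite -ltnS (leq_trans _ Nk)// ltnS subnS prednK// subn_gt0.
exists b2, n'; split => //; first exact: leq_trans len'.
by move=> j jn; rewrite agr ?b'lt// ltnS ltnW.
Qed.

(* [r l] may be smaller than [N l]: [has_dim] counts functions, and some of them
   may vanish almost everywhere. *)
Lemma orthonormal_chain (W : nat -> set (D -> C)) (N : nat -> nat) :
  (forall l, has_dim (W l) (N l)) -> (forall l f, W l f -> inL2 f) ->
  (forall l, W l `<=` W l.+1) ->
  exists (b : nat -> D -> C) (r : nat -> nat), [/\
    (forall l, (r l <= r l.+1)%N), (forall l, (r l <= N l)%N),
    (forall l, onsys b (r l)),
    (forall l k, (k < r l)%N -> W l (b k)) &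
    forall l f, W l f -> sq2 (fsub f (orthproj b (r l) f)) = 0].
Proof.
move=> dW WL2 Wsub.
pose T := ((nat -> D -> C) * nat)%type.
pose good l (p : T) := [/\ onsys p.1 p.2,
  (forall k, (k < p.2)%N -> W l (p.1 k)) &
  forall f, W l f -> sq2 (fsub f (orthproj p.1 p.2 f)) = 0].
have start : exists p, good 0 p.
  have on0 : onsys (fun _ _ => 0) 0 by split.
  have [|b [n [_ _ a1 a2 a3]]] := orthonormal_extend (dW 0) (WL2 0) on0.
    by [].
  by exists (b, n).
have step l p : exists q : T, good l p -> good l.+1 q /\
    ((p.2 <= q.2)%N /\ forall k, (k < p.2)%N -> q.1 k = p.1 k).
  have [gp|] := pselect (good l p); last by exists p.
  have [onp Wp _] := gp.
  have [|b [n [le_n agr a1 a2 a3]]] := orthonormal_extend (dW l.+1) (WL2 l.+1) onp.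
    by move=> k kn; apply/Wsub/Wp.
  by exists (b, n).
have [p0 gp0] := start.
have /choice[F FP] : forall lp : nat * T, exists q : T,
    good lp.1 lp.2 -> good lp.1.+1 q /\
    ((lp.2.2 <= q.2)%N /\ forall k, (k < lp.2.2)%N -> q.1 k = lp.2.1 k).
  by move=> [l p]; apply: step.
have [s [s0 sS]] : exists s : nat -> T, s 0%N = p0 /\ forall l, s l.+1 = F (l, s l).
  by exists (fix s l := if l is l'.+1 then F (l', s l') else p0).
have gs l : good l (s l).
  elim: l => [|l ih]; first by rewrite s0.
  by rewrite sS; have [] := FP (l, s l) ih.
have ss l : ((s l).2 <= (s l.+1).2)%N /\
    forall k, (k < (s l).2)%N -> (s l.+1).1 k = (s l).1 k.
  by rewrite sS; have [] := FP (l, s l) (gs l).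
pose r l := (s l).2.
have rmono l j : (r l <= r (l + j))%N.
  by elim: j => [|j ih]; rewrite ?addn0// addnS (leq_trans ih)//; case: (ss (l + j)%N).
have agree l j k : (k < r l)%N -> (s (l + j)%N).1 k = (s l).1 k.
  move=> kr; elim: j => [|j ih]; first by rewrite addn0.
  rewrite addnS (ss (l + j)%N).2 ?ih//; exact: leq_trans kr (rmono l j).
(* The stages agree wherever they are defined, so [b k] may be read off at any stage that has
   reached k. *)
have /choice[b bP] : forall k, exists f, forall l, (k < r l)%N -> f = (s l).1 k.
  move=> k; have [[l0 kl0]|h] := pselect (exists l, (k < r l)%N).
    exists ((s l0).1 k) => l kl; have [le|/ltnW le] := leqP l l0.
      by rewrite -(subnKC le) agree.
    by rewrite -(subnKC le) agree.
  by exists (fun=> 0) => l kl; exfalso; apply: h; exists l.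
have onbr l : onsys b (r l).
  have [[h1 h2] _ _] := gs l; split=> [i il|i j il jl].
    by rewrite (bP _ l)//; apply: h1.
  by rewrite (bP _ l)// (bP j l)//; apply: h2.
have Wb l k : (k < r l)%N -> W l (b k).
  by move=> kl; rewrite (bP _ l)//; have [_ h _] := gs l; apply: h.
exists b, r; split => //.
- by move=> l; case: (ss l).
- by move=> l; apply: orthonormal_le_dim (dW l) (onbr l) (Wb l).
- move=> l f Wf; have [_ _ /(_ f Wf)] := gs l.
  suff -> : orthproj (s l).1 (s l).2 f = orthproj b (r l) f by [].
  apply/funext => x; rewrite /orthproj /comb; apply: eq_bigr => k _.
  by rewrite (bP k l)//; apply: ltn_ord.
Qed.

End InnerProduct.

(** * Choice of the sampling points *)

Section DiagonalForms.
Context {R : rcfType}.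
Local Notation C := R[i].
Local Notation rc := (real_complex R).

Lemma qf_diag n (a : 'I_n -> R) (v : 'rV[C]_n) :
  qf (diag_mx (\row_j rc (a j))) v = \sum_j a j * sqn (v 0 j).
Proof.
rewrite /qf /rtr trace_mx11 mxE Re_sum; apply: eq_bigr => j _.
rewrite mul_mx_diag adjE !mxE mulrAC mulJ_sqn mulrC.
by rewrite reZ.
Qed.

Lemma adj_diag n (a : 'I_n -> R) :
  adj (diag_mx (\row_j rc (a j))) = diag_mx (\row_j rc (a j)).
Proof.
apply/matrixP => i j; rewrite adjE !mxE eq_sym; case: eqP => [->|_].
  by rewrite !mulr1n conjc_rc.
by rewrite !mulr0n conjc0.
Qed.

Lemma psd_diag_mx n (a : 'I_n -> R) : (forall j, 0 <= a j) ->
  psd (diag_mx (\row_j rc (a j))).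
Proof.
move=> a0; split; first exact: adj_diag.
by move=> v; rewrite qf_diag; apply: sumr_ge0 => j _; rewrite mulr_ge0 ?sqn_ge0.
Qed.

Lemma rtr_diag n (a : 'I_n -> R) : rtr (diag_mx (\row_j rc (a j))) = \sum_j a j.
Proof. by rewrite /rtr mxtrace_diag Re_sum; apply: eq_bigr => j _; rewrite mxE. Qed.

Lemma diag_mulV n (a : 'I_n -> R) : (forall j, a j != 0) ->
  diag_mx (\row_j rc (a j)^-1) *m diag_mx (\row_j rc (a j)) = 1%:M.
Proof.
move=> a0; rewrite mulmx_diag -diag_const_mx; congr diag_mx; apply/rowP => j.
by rewrite !mxE -rmorphM /= mulVf.
Qed.

Lemma Re_le_sqn (y z : C) : complex.Re (y * conjc z) ^+ 2 <= sqn y * sqn z.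
Proof.
rewrite -(sqn_conj z) -sqnM /sqn lerDl; exact: sqr_ge0.
Qed.

Lemma weighted_cauchy_schwarz I (s : seq I) (t : I -> R) (c e : I -> C) :
  (forall k, 0 < t k) ->
  sqn (\sum_(k <- s) c k * e k) <=
  (\sum_(k <- s) sqn (c k) / t k) * \sum_(k <- s) t k * sqn (e k).
Proof.
move=> t0; elim: s => [|k s ih]; first by rewrite !big_nil sqn0 mul0r.
rewrite !big_cons; set S := \sum_(_ <- s) _ in ih *.
set A := \sum_(_ <- s) _ in ih *; set B := \sum_(_ <- s) _ in ih *.
have A0 : 0 <= A.
  by apply: sumr_ge0 => j _; apply: divr_ge0; rewrite ?sqn_ge0// ltW.
have B0 : 0 <= B.
  by apply: sumr_ge0 => j _; apply: mulr_ge0; rewrite ?sqn_ge0// ltW.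
set a := sqn (c k) / t k; set b := t k * sqn (e k).
have a0 : 0 <= a by apply: divr_ge0; rewrite ?sqn_ge0// ltW.
have b0 : 0 <= b by apply: mulr_ge0; rewrite ?sqn_ge0// ltW.
have ab : sqn (c k * e k) = a * b by rewrite sqnM /a /b; field; rewrite gt_eqF.
rewrite sqnD ab; set y := complex.Re _.
have y2 : y ^+ 2 <= (a * b) * sqn S by rewrite -ab; apply: Re_le_sqn.
have y2' : y ^+ 2 <= (a * b) * (A * B).
  by apply: le_trans y2 _; apply: ler_wpM2l; [exact: mulr_ge0 | exact: ih].
suff : 2 * y <= A * b + a * B by lra.
rewrite leNgt; apply/negP => h.
have p0 : 0 <= A * b + a * B by rewrite addr_ge0// mulr_ge0.
have h2 : (A * b + a * B) ^+ 2 < (2 * y) ^+ 2.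
  by rewrite ltr_pXn2r// nnegrE// (le_trans p0)// ltW.
have := sqr_ge0 (A * b - a * B); nra.
Qed.

End DiagonalForms.

(** * Finding a point by averaging over the measure *)

Section Selection.
Context {R : realType} {d : measure_display} {D : measurableType d}.
Variable mu : {measure set D -> \bar R}.
Local Notation C := R[i].
Local Notation rc := (real_complex R).
Local Notation Re := (@complex.Re R).
Local Notation inL2 := (inL2 mu).
Local Notation ip := (ip mu).
Local Notation sq2 := (sq2 mu).

Lemma rint_sum_cond I (s : seq I) (P : pred I) (F : I -> D -> R) :
  (forall i, P i -> rintegrable mu (F i)) ->
  rintegrable mu (fun x => \sum_(i <- s | P i) F i x) /\
  rint mu (fun x => \sum_(i <- s | P i) F i x) = \sum_(i <- s | P i) rint mu (F i).
Proof.
move=> h; elim: s => [|i s [ih1 ih2]].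
  under eq_fun do rewrite big_nil; rewrite big_nil rint0.
  by split => //; exact: rintegrable0.
under eq_fun do rewrite big_cons; rewrite big_cons.
have := h i; case: (P i) => [/(_ isT) hi|_] //; split; first exact: rintegrableD.
by rewrite rintD// ih2.
Qed.

(** The conjugates make the pairing with a row of coefficients a linear combination of the values
    [e j x]. *)
Definition frame_row n (e : 'I_n -> D -> C) (x : D) : 'rV[C]_n :=
  \row_j conjc (e j x).

Lemma frame_rowE n (e : 'I_n -> D -> C) x (v : 'rV[C]_n) :
  (v *m adj (frame_row e x)) 0 0 = \sum_j v 0 j * e j x.
Proof. by rewrite mxE; apply: eq_bigr => j _; rewrite adjE mxE conjcK. Qed.

(** Orthonormality says that the rank-one matrices of the rows integrate to the identity. A
    comparison of traces thus becomes one of integrals. *)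
Lemma qf_frame n (e : 'I_n -> D -> C) (A : 'M[C]_n) :
  (forall i, inL2 (e i)) -> (forall i j, ip (e i) (e j) = (i == j)%:R) ->
  rintegrable mu (fun x => qf A (frame_row e x)) /\
  rint mu (fun x => qf A (frame_row e x)) = rtr A.
Proof.
move=> he on.
pose F (ij : 'I_n * 'I_n) x := A ij.1 ij.2 * (e ij.2 x * conjc (e ij.1 x)).
have iF ij : cintegrable mu (F ij) by apply/cintegrableZ/mul_cintegrable.
have FE x : qf A (frame_row e x) = Re (\sum_ij F ij x).
  rewrite /qf /rtr trace_mx11 frame_rowE; congr (complex.Re _).
  under eq_bigr do rewrite mxE mulr_suml.
  rewrite exchange_big pair_big/=; apply: eq_bigr => -[i j] _ /=.
  by rewrite /F !mxE /=; ring.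
have [iR _] := cintegrable_sum (index_enum _) iF.
have -> : (fun x => qf A (frame_row e x)) = fun x => Re (\sum_ij F ij x).
  by apply/funext => x; rewrite FE.
split => //.
rewrite -[LHS]/(Re (cint mu (fun x => \sum_ij F ij x))) cint_sum//.
rewrite /rtr /mxtrace; congr (complex.Re _).
have -> : \sum_ij cint mu (F ij) = \sum_i \sum_j A i j * (j == i)%:R.
  rewrite pair_big/=; apply: eq_bigr => -[i j] _ /=.
  rewrite cintZ; last exact: mul_cintegrable.
  by rewrite -[cint _ _]/(ip (e j) (e i)) on.
apply: eq_bigr => i _; rewrite (bigD1 i)//= eqxx mulr1 big1 ?addr0// => j ji.
by rewrite (negbTE ji) mulr0.
Qed.

(** If u - v were at most [tau] at every good point where [tau] is finite, then the integral of u -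
    v would be at most that of [tau], hence at most e. *)
Lemma exists_good (good : D -> Prop) (u v : D -> R) (tau : D -> \bar R) (e : R) :
  {ae mu, forall x, good x} -> rintegrable mu u -> rintegrable mu v ->
  measurable_fun setT tau -> (forall x, (0 <= tau x)%E) ->
  (\int[mu]_x tau x <= e%:E)%E -> rint mu v + e < rint mu u ->
  exists x, [/\ good x, (tau x < +oo)%E & v x + fine (tau x) < u x].
Proof.
move=> aeg iu iv mt t0 te lt; apply: contrapT => no.
(* The positive part lets the comparison run through monotonicity of integrals of nonnegative
   functions, where [tau] may take the value +oo. *)
pose g x := u x - v x; pose gp x := Num.max (g x) 0.
have ig : rintegrable mu g by apply: rintegrableB.
have mg : measurable_fun setT g.
  by apply/measurable_EFinP; apply: measurable_int ig.
have mgp : measurable_fun setT gp by apply: measurable_maxr => //.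
have igp : rintegrable mu gp.
  apply: (rintegrable_le (v := fun x => `|g x|)) => //.
    by move=> x; rewrite /gp maxEle; case: ifP => _; rewrite ?normr0 ?normr_ge0.
  by have := integrable_abse ig.
have aele : {ae mu, forall x, setT x -> ((gp x)%:E <= tau x)%E}.
  apply: filterS aeg => x gx _.
  have [ty|] := ltP (tau x) +oo%E; last by rewrite leye_eq => /eqP ->; rewrite leey.
  have tf : tau x \is a fin_num by rewrite ge0_fin_numE.
  rewrite -(fineK tf) lee_fin /gp ge_max fine_ge0// andbT.
  rewrite leNgt; apply/negP => h; apply: no; exists x; split => //.
  by move: h; rewrite /g; lra.
have le1 : (\int[mu]_x (gp x)%:E <= e%:E)%E.
  apply: le_trans te; apply: ae_ge0_le_integral => //.
    by move=> x _; rewrite lee_fin /gp le_max lexx orbT.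
  exact/measurable_EFinP.
rewrite rintegrable_EFin// lee_fin in le1.
have : rint mu g <= rint mu gp.
  by apply: le_Rintegral => // x _; rewrite /gp le_max lexx.
rewrite rintB//; lra.
Qed.

End Selection.

(** * Sampling points for all coordinates, near and far *)

Section Sampling.
Context {R : realType} {d : measure_display} {D : measurableType d}.
Variable mu : {measure set D -> \bar R}.
Local Notation C := R[i].
Local Notation rc := (real_complex R).
Variables (b : nat -> D -> C) (r : nat -> nat) (m : nat) (tt : nat -> R).
Hypotheses (r_mono : forall l, (r l <= r l.+1)%N)
  (onb : forall l, onsys mu b (r l)).
Hypotheses (r0_gt0 : (0 < r 0)%N) (r0_le : (r 0 <= m)%N).
Hypotheses (tt_gt0 : forall k, 0 < tt k) (tt_le2 : forall k, tt k <= 2).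
Hypothesis tt_sum : forall L, \sum_(r 0 <= k < r L) tt k <= 6 * m%:R.

Let r_le l l' : (l <= l')%N -> (r l <= r l')%N.
Proof.
move=> h; rewrite -(subnKC h); elim: (l' - l)%N => [|j ih]; first by rewrite addn0.
by rewrite addnS; apply: leq_trans ih _.
Qed.

(** 1/8 is the slack that the barrier argument leaves for [tau]. *)
Let tail_small : exists L, forall L', (L <= L')%N ->
  \sum_(r L <= k < r L') tt k <= 8^-1.
Proof.
pose A := [set \sum_(r 0 <= k < r L) tt k | L in [set: nat]].
have supA : has_sup A.
  split; first by exists (\sum_(r 0 <= k < r 0) tt k), 0.
  by exists (6 * m%:R) => _ [L _ <-].
have e0 : 0 < 8^-1 :> R by rewrite invr_gt0.
have [_ [L _ <-] hL] := sup_adherent e0 supA.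
exists L => L' LL'.
have : \sum_(r 0 <= k < r L') tt k <= sup A by apply: sup_upper_bound => //; exists L'.
rewrite (big_cat_nat (r_le (leq0n L)) (r_le LL'))/=; lra.
Qed.

(** The first [r 0] coordinates drive the lower barrier, those from [r 0] to [r L0] the upper one,
    and the others enter through [tau]. The last bound is uniform in [L], so that it survives the
    limit along the projections. *)
Lemma sampling_points (good : D -> Prop) : {ae mu, forall x, good x} ->
  exists (s : seq (D * R)) (L0 : nat), [/\ size s = (5 * m)%N,
    forall xw, List.In xw s -> good xw.1 /\ 0 < xw.2,
    forall c : nat -> C, m%:R * \sum_(k < r 0) sqn (c k) <=
      \sum_(xw <- s) xw.2 * sqn (comb b (r 0) c xw.1) &
    forall (c : nat -> C) L, (L0 <= L)%N -> (forall k, (k < r 0)%N -> c k = 0) ->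
      \sum_(xw <- s) xw.2 * sqn (comb b (r L) c xw.1) <=
      256 * m%:R * \sum_(r 0 <= k < r L) sqn (c k) / tt k].
Proof.
move=> aeg; have [L0 small] := tail_small.
pose r0 := r 0%N; pose K := r L0.
have r0K : (r0 <= K)%N by apply: r_le.
have bL2 l k : (k < r l)%N -> inL2 mu (b k) by apply: (onb l).1.
(* Beyond index [K] the trace of the frame operator is so small that no barrier is
   needed: this keeps the matrices finite. *)
pose blk l x := \sum_(r (L0 + l)%N <= k < r (L0 + l).+1) tt k * sqn (b k x).
have blk0 l x : 0 <= blk l x.
  by apply: sumr_ge0 => k _; apply: mulr_ge0; rewrite ?sqn_ge0// ltW.
pose tau x := (\sum_(l <oo) (blk l x)%:E)%E.
have blk_int l : rintegrable mu (blk l) /\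
    rint mu (blk l) = \sum_(r (L0 + l)%N <= k < r (L0 + l).+1) tt k.
  have blkE : blk l = fun x => \sum_(r (L0 + l)%N <= k < r (L0 + l).+1 |
      (r (L0 + l)%N <= k < r (L0 + l).+1)%N) tt k * sqn (b k x).
    by apply/funext => x; rewrite /blk big_nat.
  have h k : (r (L0 + l)%N <= k < r (L0 + l).+1)%N ->
      rintegrable mu (fun x => sqn (b k x)).
    by move=> /andP[_ kl]; have /inL2_rintegrable[] := bL2 _ _ kl.
  have [h1 h2] := rint_sum_cond (index_iota (r (L0 + l)%N) (r (L0 + l).+1))
    (fun k kl => rintegrableZ (tt k) (h k kl)).
  rewrite blkE; split => //; rewrite h2 [RHS]big_nat; apply: eq_bigr => k kl.
  rewrite rintZ; last exact: h.
  have /andP[_ kl'] := kl; have bk := bL2 _ _ kl'.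
  rewrite -sq2E -[sq2 _ _]/(complex.Re (rc _)) -ipff//.
  by rewrite ((onb _).2 _ _ kl' kl') eqxx mulr1.
have mblk l : measurable_fun setT (EFin \o blk l).
  by apply: measurable_int (blk_int l).1.
have tau0 x : (0 <= tau x)%E by apply: nneseries_ge0 => l _ _; rewrite lee_fin.
have mtau : measurable_fun setT tau.
  apply: (ge0_emeasurable_sum (h := fun l x => (blk l x)%:E) (P := xpredT)) => //.
    by move=> l x _ _; rewrite lee_fin.
  by move=> l _; apply: mblk.
have tau_int : (\int[mu]_x tau x <= (8^-1)%:E)%E.
  rewrite integral_nneseries//; last by move=> l x _; rewrite lee_fin.
  under eq_eseriesr => l _ do rewrite (rintegrable_EFin (blk_int l).1) (blk_int l).2.
  apply: lime_le.
    apply: is_cvg_nneseries => l _ _; rewrite lee_fin.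
    by apply: sumr_ge0 => k _; rewrite ltW.
  apply: nearW => n; rewrite sumEFin lee_fin big_mkord.
  have -> : \sum_(l < n) \sum_(r (L0 + l)%N <= k < r (L0 + l).+1) tt k =
      \sum_(r L0 <= k < r (L0 + n)%N) tt k.
    elim: n => [|n ih]; first by rewrite big_ord0 addn0 big_geq.
    rewrite big_ord_recr ih addnS /= -big_cat_nat//; exact/r_le/leq_addr.
  exact/small/leq_addr.
pose e1 (j : 'I_r0) := b j.
(* The shift by [r0] drops the functions spanning the first level; the upper barrier concerns only
   the complement. *)
pose e2 (j : 'I_(K - r0)) := b (j + r0)%N.
have jK (j : 'I_(K - r0)) : (j + r0 < K)%N by rewrite addnC -ltn_subRL ltn_ord.
have he1 j : inL2 mu (e1 j) by apply: (bL2 0%N); apply: ltn_ord.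
have he2 j : inL2 mu (e2 j) by apply: (bL2 L0); apply: jK.
have on1 i j : ip mu (e1 i) (e1 j) = (i == j)%:R.
  by rewrite (onb 0).2 ?ltn_ord.
have on2 i j : ip mu (e2 i) (e2 j) = (i == j)%:R.
  by rewrite (onb L0).2 ?jK// eqn_add2r.
pose dd (j : 'I_(K - r0)) := tt (j + r0)%N.
have dd0 j : 0 < dd j by apply: tt_gt0.
have sumdd (F : nat -> R) : \sum_(j < K - r0) F (j + r0)%N = \sum_(r0 <= k < K) F k.
  by have := @big_addn _ 0 +%R 0%N K r0 xpredT F; rewrite add0n => ->; rewrite big_mkord.
pose tau' x := fine (tau x).
have tau'0 x : 0 <= tau' x by apply: fine_ge0.
have sel (P : 'M[C]_r0) (Q : 'M[C]_(K - r0)) : rtr Q + 8^-1 < rtr P ->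
    exists x, (good x /\ (tau x < +oo)%E) /\
      qf Q (frame_row e2 x) + tau' x < qf P (frame_row e1 x).
  move=> PQ; have [iP intP] := qf_frame P he1 on1.
  have [iQ intQ] := qf_frame Q he2 on2.
  rewrite -intP -intQ in PQ.
  have [x [gx tx hx]] := exists_good aeg iP iQ mtau tau0 tau_int PQ.
  by exists x.
have [||||s [ss gs ts lo up]] := barrier_points (DI := diag_mx (\row_j rc (dd j)))
  (D := diag_mx (\row_j rc (dd j)^-1)) r0_gt0 r0_le tau'0 _ _ _ _ sel.
- by apply: diag_mulV => j; rewrite gt_eqF.
- by apply: psd_diag_mx => j; rewrite ltW.
- by rewrite rtr_diag (sumdd tt); exact: tt_sum.
- move=> v; rewrite qf1E qf_diag mulr_sumr; apply: ler_sum => j _.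
  rewrite mulrA ler_peMl ?sqn_ge0// ler_pdivlMr// mul1r; exact: tt_le2.
exists s, L0; split => //.
- by move=> xw /gs[[]].
- move=> c; have := lo (\row_(j < r0) c j).
  under eq_bigr do rewrite mxE.
  move=> /le_trans; apply; rewrite le_eqVlt; apply/orP; left; apply/eqP.
  apply: eq_bigr => xw _; rewrite frame_rowE; congr (_ * sqn _).
  by apply: eq_bigr => j _; rewrite mxE.
move=> c L LL c0.
have KL : (K <= r L)%N by apply: r_le.
set Z1 := \sum_(r0 <= k < K) sqn (c k) / tt k.
set Z2 := \sum_(K <= k < r L) sqn (c k) / tt k.
have Z20 : 0 <= Z2.
  by apply: sumr_ge0 => k _; apply: divr_ge0; rewrite ?sqn_ge0 ?ltW.
have -> : \sum_(r 0 <= k < r L) sqn (c k) / tt k = Z1 + Z2.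
  by rewrite (big_cat_nat r0K KL).
pose h1 x := \sum_(j < K - r0) c (j + r0)%N * e2 j x.
pose h2 x := \sum_(K <= k < r L) c k * b k x.
have combE x : comb b (r L) c x = h1 x + h2 x.
  rewrite /comb -(big_mkord xpredT (fun k => c k * b k x)).
  rewrite (big_cat_nat (leq0n r0) (leq_trans r0K KL)) (big_cat_nat r0K KL) /=.
  rewrite big_nat big1 ?add0r; last by move=> k /andP[_ kr]; rewrite c0 ?mul0r.
  congr (_ + _); have := @big_addn _ 0 +%R 0%N K r0 xpredT (fun k => c k * b k x).
  by rewrite add0n => ->; rewrite big_mkord.
(* Weighted Cauchy-Schwarz leaves the factor sum of tt k |b k x|^2 over K <= k < r L, a partial sum
   of the series [tau x]. *)
have h2_le x : (tau x < +oo)%E -> sqn (h2 x) <= Z2 * tau' x.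
  move=> tx; apply: le_trans (weighted_cauchy_schwarz _ _ _ tt_gt0) _.
  rewrite -/Z2; apply: ler_wpM2l => //.
  rewrite -lee_fin fineK ?ge0_fin_numE//.
  apply: le_trans (nneseries_lim_ge (L - L0) _); last by move=> *; rewrite lee_fin.
  rewrite sumEFin lee_fin big_mkord le_eqVlt; apply/orP; left; apply/eqP.
  rewrite -{1}(subnKC LL); elim: (L - L0)%N => [|n ih].
    by rewrite big_ord0 addn0 big_geq.
  rewrite big_ord_recr -ih /= addnS (big_cat_nat (n := r (L0 + n)%N))//.
  exact/r_le/leq_addr.
have : \sum_(xw <- s) xw.2 * sqn (h1 xw.1) <= 128 * m%:R * Z1.
  have := up (\row_j c (j + r0)%N).
  rewrite qf_diag.
  under [X in _ <= _ * X -> _]eq_bigr do rewrite mxE mulrC.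
  rewrite (sumdd (fun k => sqn (c k) / tt k)) => /(le_trans _); apply.
  rewrite le_eqVlt; apply/orP; left; apply/eqP.
  apply: eq_bigr => xw _; rewrite frame_rowE; congr (_ * sqn _).
  by apply: eq_bigr => j _; rewrite mxE.
have : \sum_(xw <- s) xw.2 * sqn (h2 xw.1) <= 5 * m%:R * Z2.
  apply: (@le_trans _ _ (\sum_(xw <- s) xw.2 * tau' xw.1 * Z2)); last first.
    by rewrite -mulr_suml ler_wpM2r.
  have : forall xw, List.In xw s -> 0 < xw.2 /\ (tau xw.1 < +oo)%E.
    by move=> xw /gs[[]].
  elim: s {ss gs ts lo up} => [|xw s ih] hs; first by rewrite !big_nil.
  rewrite !big_cons lerD ?ih//; last by move=> y ys; apply: hs; right.
  have [|w0 tx] := hs xw; first by left.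
  by rewrite -mulrA ler_pM2l// mulrC; apply: h2_le.
(* The square of a sum costs a factor 2, so 128 and 5 become 256 and 10; the constant 256 covers
   both parts. *)
have : \sum_(xw <- s) xw.2 * sqn (comb b (r L) c xw.1) <=
    2 * (\sum_(xw <- s) xw.2 * sqn (h1 xw.1)) + 2 * \sum_(xw <- s) xw.2 * sqn (h2 xw.1).
  have : forall xw, List.In xw s -> 0 < xw.2 by move=> xw /gs[].
  elim: s {ss gs ts lo up} => [|xw s ih] hs; first by rewrite !big_nil mulr0 addr0.
  have {}ih := ih (fun y ys => hs y (or_intror ys)).
  have w0 := hs xw (or_introl erefl).
  rewrite !big_cons combE.
  have : xw.2 * sqn (h1 xw.1 + h2 xw.1) <=
      xw.2 * (2 * sqn (h1 xw.1) + 2 * sqn (h2 xw.1)) by rewrite ler_pM2l ?sqnD_le.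
  lra.
have m0 : 0 <= m%:R :> R by [].
nra.
Qed.

End Sampling.

(** * Tails and dyadic comparison of series *)

Section RealSums.
Context {R : realType}.

Lemma bounded_sum_tail (y : nat -> R) (M e : R) : 
  (forall n, \sum_(0 <= l < n) y l <= M) -> 0 < e ->
  exists L, forall L', (L <= L')%N -> \sum_(L <= l < L') y l <= e.
Proof.
move=> yM e0; pose A := [set \sum_(0 <= l < n) y l | n in [set: nat]].
have supA : has_sup A.
  split; first by exists (\sum_(0 <= l < 0) y l), 0%N.
  by exists M => _ [L _ <-].
have [_ [L _ <-] hL] := sup_adherent e0 supA.
exists L => L' LL'.
have : \sum_(0 <= l < L') y l <= sup A by apply: sup_upper_bound => //; exists L'.
by rewrite (big_cat_nat (leq0n L) LL') /=; lra.
Qed.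

(** With M = 2^l m, the block M/2 < k <= M contains at least M/2 integers, so [g l] is at most the
    sum of F over it. The blocks are disjoint, and the first begins beyond m/4. *)
Lemma dyadic_sum (m : nat) (F g : nat -> R) (J : nat) :
  (forall k, (m %/ 4 < k)%N -> 0 <= F k) ->
  (forall l k, (2 ^ l * m < 2 * k)%N -> (k <= 2 ^ l * m)%N ->
    g l <= (2 ^ l * m)%:R / 2 * F k) ->
  (0 < m)%N ->
  \sum_(0 <= l < J.+1) g l <= \sum_((m %/ 4).+1 <= k < (2 ^ J * m).+1) F k.
Proof.
move=> F0 hg m0.
have block l : g l <= \sum_(((2 ^ l * m) %/ 2).+1 <= k < (2 ^ l * m).+1) F k.
  set M := (2 ^ l * m)%N in hg *.
  have M0 : (0 < M)%N by rewrite muln_gt0 expn_gt0.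
  have [g0|g0] := leP (g l) 0.
    apply: le_trans g0 _; rewrite big_nat; apply: sumr_ge0 => k /andP[hk _].
    apply: F0; apply: leq_ltn_trans hk; rewrite -(@leq_pmul2r 4)//.
    have : (m <= M)%N by rewrite leq_pmull// expn_gt0.
    by have := leq_trunc_div m 4; have := leq_trunc_div M 2; lia.
  pose N := ((M.+1 - (M %/ 2).+1)%N).
  have : N%:R * (2 * g l / M%:R) <= \sum_((M %/ 2).+1 <= k < M.+1) F k.
    rewrite mulrC mulr_natr -sumr_const_nat big_nat [leRHS]big_nat.
    apply: ler_sum => k /andP[k1 k2].
    have := hg l k; rewrite -/M => /(_ _ _)/wrap[||].
    - by move: k1; lia.
    - by rewrite -ltnS.
    have M0' : 0 < M%:R :> R by rewrite ltr0n.
    by rewrite ler_pdivrMr//; lra.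
  apply: le_trans.
  have M0' : 0 < M%:R :> R by rewrite ltr0n.
  have : M%:R <= 2 * N%:R :> R.
    by rewrite -natrM ler_nat /N; lia.
  move=> h; rewrite mulrA ler_pdivlMr//; nra.
have e0 : (m %/ 4 <= (2 ^ 0 * m) %/ 2)%N by rewrite mul1n; lia.
elim: J => [|J ih].
  rewrite big_nat1; apply: le_trans (block 0%N) _.
  rewrite (big_cat_nat (m := (m %/ 4).+1) (n := (2 ^ 0 * m %/ 2).+1))//=; last first.
    by rewrite mul1n; lia.
  rewrite lerDr big_nat; apply: sumr_ge0 => k /andP[hk _]; exact: F0.
rewrite big_nat_recr//=; apply: le_trans (lerD ih (block J.+1)) _.
have -> : ((2 ^ J.+1 * m) %/ 2 = 2 ^ J * m)%N by rewrite expnS -mulnA mulKn.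
rewrite -big_cat_nat//; first by rewrite ltnS; nia.
by rewrite ltnS leq_mul2r leq_exp2l ?leqnSn ?orbT.
Qed.

Lemma sum_inv_pow2 (n : nat) : \sum_(0 <= l < n) (2 ^+ l)^-1 <= 2 :> R.
Proof.
suff -> : \sum_(0 <= l < n) (2 ^+ l)^-1 = 2 - 2 * (2 ^+ n)^-1 :> R.
  by rewrite gerBl mulr_ge0// invr_ge0 exprn_ge0.
elim: n => [|n ih]; first by rewrite big_geq// expr0 invr1; lra.
by rewrite big_nat_recr//= ih exprS invfM; lra.
Qed.

End RealSums.

(** * Weighted least squares *)

Section LeastSquares.
Context {R : realType} {d : measure_display} {D : measurableType d}.
Variable mu : {measure set D -> \bar R}.
Local Notation C := R[i].
Local Notation rc := (real_complex R).

Lemma In_tnth T (s : seq T) (i : 'I_(size s)) : List.In (tnth (in_tuple s) i) s.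
Proof.
have x0 := tnth (in_tuple s) i; rewrite (tnth_nth x0) /=.
have : (i < size s)%N := ltn_ord i; move: (nat_of_ord i) => {i}.
elim: s => // y s ih [|j] /= js; first by left.
by right; apply: ih.
Qed.

Lemma sampling_sub n (x : 'I_n -> D) (phi : 'I_n -> D -> C) f g :
  sampling_algorithm x phi (fsub f g) =
  fsub (sampling_algorithm x phi f) (sampling_algorithm x phi g).
Proof.
apply/funext => y; rewrite /sampling_algorithm /fsub -sumrB.
by apply: eq_bigr => i _; rewrite mulrBl.
Qed.

(** The lower bound makes the weighted Gram matrix [A] invertible with A >= m. The coefficients of
    the solution are linear in the samples, which gives [phi]; it reproduces the span, and its
    weighted sample norm cannot exceed that of the data. *)
Lemma least_squares (b : nat -> D -> C) n (s : seq (D * R)) (m : R) :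
  0 < m -> onsys mu b n ->
  (forall c : nat -> C, m * \sum_(k < n) sqn (c k) <=
    \sum_(xw <- s) xw.2 * sqn (comb b n c xw.1)) ->
  (forall xw, List.In xw s -> 0 < xw.2) ->
  let x i := (tnth (in_tuple s) i).1 in
  exists phi : 'I_(size s) -> D -> C, [/\
    forall i, exists c, phi i = comb b n c,
    forall c, sampling_algorithm x phi (comb b n c) = comb b n c &
    forall h, inL2 mu (sampling_algorithm x phi h) /\
      m * sq2 mu (sampling_algorithm x phi h) <=
      \sum_(xw <- s) xw.2 * sqn (h xw.1)].
Proof.
move=> m0 onb lo w0 x.
pose w i := (tnth (in_tuple s) i).2.
pose P i : 'rV[C]_n := frame_row (fun j : 'I_n => b j) (x i).
pose A : 'M[C]_n := \sum_i rc (w i) *: (adj (P i) *m P i).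
have wge0 i : 0 <= w i.
  by rewrite ltW//; apply: w0; apply: In_tnth.
pose ext (v : 'rV[C]_n) k := if insub k is Some i then v 0 (i : 'I_n) else 0.
have extE v (k : 'I_n) : ext v k = v 0 k by rewrite /ext valK.
have combE v i : comb b n (ext v) (x i) = (v *m adj (P i)) 0 0.
  by rewrite frame_rowE; apply: eq_bigr => j _; rewrite extE.
have sumE (F : D -> R) : \sum_(xw <- s) xw.2 * F xw.1 = \sum_i w i * F (x i).
  by rewrite big_tnth.
have qfA v : qf A v = \sum_i w i * sqn ((v *m adj (P i)) 0 0).
  rewrite /A (big_morph (fun B => qf B v) (id1 := 0) (op1 := +%R)).
  - by apply: eq_bigr => i _; rewrite qfZ qf_rank1.
  - by move=> B B'; exact: qfD.
  - by rewrite /qf mulmx0 mul0mx /rtr linear0.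
have loA v : m * qf 1%:M v <= qf A v.
  have := lo (ext v); rewrite (sumE (fun y => sqn (comb b n (ext v) y))) qf1E qfA.
  under eq_bigr do rewrite extE.
  by under [X in _ <= X -> _]eq_bigr do rewrite combE.
have uA : A \in unitmx.
  apply: (@unitmx_bound _ _ _ m^-1) => v.
  by rewrite ler_pdivlMl.
have mulA v : v *m A = \sum_i (rc (w i) * (v *m adj (P i)) 0 0) *: P i.
  rewrite /A mulmx_sumr; apply: eq_bigr => i _.
  rewrite -scalemxAr mulmxA -scalerA; congr (_ *: _).
  by rewrite {1}[v *m adj (P i)]mx11_scalar mul_scalar_mx.
pose dd (h : D -> C) : 'rV[C]_n := (\sum_i (rc (w i) * h (x i)) *: P i) *m invmx A.
pose phi i := comb b n (ext ((rc (w i) *: P i) *m invmx A)).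
have algE h : sampling_algorithm x phi h = comb b n (ext (dd h)).
  apply/funext => y; rewrite /sampling_algorithm /phi /comb.
  under eq_bigr do rewrite mulr_sumr.
  rewrite exchange_big; apply: eq_bigr => j _ /=.
  rewrite extE /dd mulmx_suml summxE mulr_suml; apply: eq_bigr => i _.
  by rewrite extE mulrA -!scalemxAl !mxE; ring.
exists phi; split.
- by move=> i; eexists.
- move=> c; rewrite algE; pose v : 'rV[C]_n := \row_j c j.
  have cE : comb b n c = comb b n (ext v).
    by apply/funext => y; apply: eq_bigr => j _; rewrite extE mxE.
  rewrite cE; congr (comb b n (ext _)).
  rewrite /dd; under eq_bigr do rewrite combE.
  by rewrite -mulA mulmxK.
- move=> h; rewrite algE; split; first exact: inL2_comb.
  rewrite sq2_comb// (sumE (fun y => sqn (h y))); under eq_bigr do rewrite extE.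
  set v := dd h.
  have := loA v; rewrite qf1E => /le_trans; apply.
  have vA : v *m A = \sum_i (rc (w i) * h (x i)) *: P i by rewrite /v /dd mulmxKV.
  (* The normal equations: the weighted pairing of the data with the solution equals the weighted
     square of the solution. Expanding the nonnegative residual then bounds the latter by the square
     of the data. *)
  have qv : qf A v = \sum_i w i * complex.Re (h (x i) * conjc ((v *m adj (P i)) 0 0)).
    rewrite /qf vA mulmx_suml /rtr trace_mx11 summxE Re_sum; apply: eq_bigr => i _.
    rewrite -scalemxAl mxE -mulrA reZ; congr (_ * complex.Re (_ * _)).
    have e : adj (v *m adj (P i)) = P i *m adj v by rewrite adjM adjK.
    by rewrite -e adjE.
  have : 0 <= \sum_i w i * sqn (h (x i) - (v *m adj (P i)) 0 0).
    by apply: sumr_ge0 => i _; rewrite mulr_ge0 ?sqn_ge0.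
  have -> : \sum_i w i * sqn (h (x i) - (v *m adj (P i)) 0 0) =
      \sum_i w i * sqn (h (x i)) - 2 * qf A v + qf A v.
    rewrite {1}qv qfA mulr_sumr -sumrB -big_split; apply: eq_bigr => i _ /=.
    by rewrite sqnB; ring.
  lra.
Qed.

End LeastSquares.

(** * The weights of the blocks *)

Section Weights.
Context {R : realType}.
Local Notation C := R[i].

Lemma sum_blocks (r : nat -> nat) (F : nat -> R) L :
  (forall l, (r l <= r l.+1)%N) ->
  \sum_(r 0%N <= k < r L) F k =
  \sum_(0 <= l < L) \sum_(r l <= k < r l.+1) F k.
Proof.
move=> rm; elim: L => [|L ih]; first by rewrite !big_geq.
rewrite big_nat_recr//= -ih -big_cat_nat//.
by elim: L {ih} => // L ih; apply: leq_trans ih _.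
Qed.

Lemma block_weights (r : nat -> nat) (m : nat) (a : nat -> R) (S : R) :
  (forall l, (r l <= r l.+1)%N) -> (forall l, (r l <= 2 ^ l * m)%N) ->
  (forall l, 0 <= a l) ->
  (forall J, \sum_(0 <= l < J) Num.sqrt (2 ^+ l) * a l <= S) ->
  exists tt : nat -> R, [/\ forall k, 0 < tt k, forall k, tt k <= 2,
    forall L, \sum_(r 0%N <= k < r L) tt k <= 6 * m%:R &
    forall (c : nat -> C) L,
      (forall l, \sum_(r l <= k < r l.+1) sqn (c k) <= a l ^+ 2) ->
      \sum_(r 0%N <= k < r L) sqn (c k) / tt k <= S ^+ 2].
Proof.
move=> rm rN a0 sumS.
have rle l l' : (l <= l')%N -> (r l <= r l')%N.
  move=> h; rewrite -(subnKC h); elim: (l' - l)%N => [|j ih]; first by rewrite addn0.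
  by rewrite addnS; apply: leq_trans ih _.
pose s l := Num.sqrt (2 ^+ l) * a l.
have s0 l : 0 <= s l by rewrite mulr_ge0 ?sqrtr_ge0.
have S0 : 0 <= S by have := sumS 0%N; rewrite big_geq.
have sS l : s l <= S.
  apply: le_trans (sumS l.+1); rewrite big_nat_recr//= lerDr.
  by apply: sumr_ge0 => i _; apply: s0.
have p2 l : 0 < 2 ^+ l :> R by apply: exprn_gt0.
have p21 l : 1 <= 2 ^+ l :> R by apply: exprn_ege1; lra.
(* Subject to [sum (2 ^ l * t l) <= 1], the sum of the [a l ^+ 2 / t l] is minimal,
   equal to [S ^+ 2], for [t l = s l / (S * 2 ^ l)]; the second summand keeps the
   weights positive when [s l = 0], or when [S = 0] and thus [s l / S = 0]. *)
pose t l := (s l / S + (2 ^+ l)^-1) / 2 ^+ l.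
have sdS l : 0 <= s l / S <= 1.
  rewrite divr_ge0//=; have [->|Sn0] := eqVneq S 0; first by rewrite invr0 mulr0.
  by rewrite ler_pdivrMr ?mul1r// lt_def Sn0.
have i2 l : 0 < (2 ^+ l : R)^-1 <= 1 by rewrite invr_gt0 p2/= invf_le1.
have t0 l : 0 < t l.
  by rewrite divr_gt0//; have /andP[? _] := sdS l; have /andP[? _] := i2 l; lra.
have t2 l : t l <= 2.
  rewrite ler_pdivrMr//; have /andP[_ ?] := sdS l; have /andP[_ ?] := i2 l.
  by have := p21 l; lra.
(* Monotonicity of [r] puts each index in at most one block; an index in none receives the harmless
   value 1. *)
have /choice[tt ttP] : forall k, exists v, [/\ 0 < v, v <= 2 &
    forall l, (r l <= k < r l.+1)%N -> v = t l].
  move=> k; have [[l0 kl0]|h] := pselect (exists l, (r l <= k < r l.+1)%N).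
    exists (t l0); split => // l /andP[kl1 kl2]; have /andP[kl3 kl4] := kl0.
    congr t; apply/eqP; rewrite eqn_leq; apply/andP; split.
      by rewrite leqNgt; apply/negP => /rle; lia.
    by rewrite leqNgt; apply/negP => /rle; lia.
  exists 1; split => //; first by lra.
  by move=> l kl; exfalso; apply: h; exists l.
have ttE l k : (r l <= k < r l.+1)%N -> tt k = t l.
  by have [_ _ h] := ttP k; apply: h.
exists tt; split.
- by move=> k; have [] := ttP k.
- by move=> k; have [] := ttP k.
- move=> L; rewrite sum_blocks//.
  (* A block has at most 2^(l+1) m indices, so its weights sum to at most 2 m (s l / S + 2^(-l)).
     The two series are at most 1 and 2, whence 6 m. *)
  apply: (@le_trans _ _ (\sum_(0 <= l < L) 2 * m%:R * (s l / S + (2 ^+ l)^-1))).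
    apply: ler_sum => l _; rewrite big_nat.
    under eq_bigr => k kl do rewrite (ttE l k kl).
    rewrite -big_nat sumr_const_nat -[leLHS]mulr_natr.
    apply: (@le_trans _ _ (t l * (2 ^ l.+1 * m)%:R)).
      by rewrite ler_pM2l// ler_nat (leq_trans (leq_subr _ _)).
    rewrite /t natrM natrX exprS.
    have -> : (s l / S + (2 ^+ l)^-1) / 2 ^+ l * (2 * 2 ^+ l * m%:R) =
       2 * m%:R * (s l / S + (2 ^+ l)^-1).
      have -> : (s l / S + (2 ^+ l)^-1) / 2 ^+ l * (2 * 2 ^+ l * m%:R) =
        (2 * m%:R * (s l / S + (2 ^+ l)^-1)) * (2 ^+ l / 2 ^+ l) by ring.
      by rewrite divff ?mulr1// gt_eqF.
    exact: lexx.
  rewrite -mulr_sumr big_split/= -mulr_suml.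
  have := sum_inv_pow2 (R := R) L.
  have : (\sum_(0 <= l < L) s l) / S <= 1.
    have [->|Sn0] := eqVneq S 0; first by rewrite invr0 mulr0.
    by rewrite ler_pdivrMr ?mul1r ?sumS// lt_def Sn0.
  have : 0 <= m%:R :> R by [].
  nra.
move=> c L hc; rewrite sum_blocks//.
apply: (@le_trans _ _ (\sum_(0 <= l < L) S * s l)); last first.
  by rewrite -mulr_sumr expr2 ler_wpM2l.
apply: ler_sum => l _; rewrite big_nat.
under eq_bigr => k kl do rewrite (ttE l k kl).
rewrite -big_nat -mulr_suml ler_pdivrMr//; apply: le_trans (hc l) _.
have s2 : s l ^+ 2 = 2 ^+ l * a l ^+ 2 by rewrite exprMn sqr_sqrtr// ltW.
(* If S = 0, all [a l] vanish and both sides are 0. *)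
have [Se|Sn0] := eqVneq S 0.
  have se0 : s l = 0 by apply/eqP; rewrite eq_le s0 -Se sS.
  move/eqP: s2; rewrite se0 expr0n eq_sym mulf_eq0 gt_eqF//= => /eqP ->.
  by rewrite Se !mul0r.
have Sp : 0 < S by rewrite lt_def Sn0.
have -> : a l ^+ 2 = s l ^+ 2 / 2 ^+ l by rewrite s2 mulrC mulKf// gt_eqF.
have -> : S * s l * t l = (s l ^+ 2 + S * s l * (2 ^+ l)^-1) / 2 ^+ l.
  by rewrite /t; field; rewrite !gt_eqF.
by rewrite ler_pM2r ?invr_gt0// lerDl mulr_ge0 ?mulr_ge0.
Qed.

End Weights.

(** * Almost everywhere convergence of the projections *)

Section Convergence.
Context {R : realType} {d : measure_display} {D : measurableType d}.
Variable mu : {measure set D -> \bar R}.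
Local Notation C := R[i].
Local Notation rc := (real_complex R).

Definition sqn_cvg (g : nat -> C) (z : C) : Prop :=
  forall e : R, 0 < e -> exists L0, forall L, (L0 <= L)%N -> sqn (z - g L) <= e.

(** Summable squared errors give the series of |f - g l|^2 a finite integral; so it converges almost
    everywhere and its terms tend to 0, for the whole sequence and not just a subsequence. *)
Lemma ae_sqn_cvg (f : D -> C) (g : nat -> D -> C) (M : R) :
  inL2 mu f -> (forall L, inL2 mu (g L)) ->
  (forall n, \sum_(0 <= l < n) sq2 mu (fsub f (g l)) <= M) ->
  {ae mu, forall x, sqn_cvg (fun L => g L x) (f x)}.
Proof.
move=> hf hg hM.
have hfg l : inL2 mu (fsub f (g l)) by apply: inL2B.
have ifg l : rintegrable mu (fun x => sqn (fsub f (g l) x)).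
  by have /inL2_rintegrable[] := hfg l.
pose T x := (\sum_(l <oo) (sqn (fsub f (g l) x))%:E)%E.
have T0 x : (0 <= T x)%E by apply: nneseries_ge0 => l _ _; rewrite lee_fin sqn_ge0.
have mT : measurable_fun setT T.
  apply: (ge0_emeasurable_sum (h := fun l x => (sqn (fsub f (g l) x))%:E) (P := xpredT)) => //.
    by move=> l x _ _; rewrite lee_fin sqn_ge0.
  by move=> l _; apply: measurable_int (ifg l).
have iT : mu.-integrable setT T.
  apply/integrableP; split => //.
  under eq_integral do rewrite gee0_abs//.
  rewrite integral_nneseries//; last 2 first.
  - by move=> l; apply: measurable_int (ifg l).
  - by move=> l x _; rewrite lee_fin sqn_ge0.
  apply: (@le_lt_trans _ _ M%:E); last exact: ltry.
  under eq_eseriesr => l _ do rewrite (rintegrable_EFin (ifg l)) -sq2E.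
  apply: lime_le.
    by apply: is_cvg_nneseries => l _ _; rewrite lee_fin sq2_ge0.
  by apply: nearW => n; rewrite sumEFin lee_fin.
have := integrable_ae measurableT iT; apply: filterS => x /(_ I) fT.
move=> e e0.
have [|L hL] := @bounded_sum_tail R (fun l => sqn (fsub f (g l) x)) (fine (T x)) e _ e0.
  move=> n; rewrite -lee_fin fineK// -sumEFin.
  by apply: nneseries_lim_ge => *; rewrite lee_fin sqn_ge0.
exists L => L' LL'; have := hL L'.+1 (leqW LL').
apply: le_trans; rewrite big_nat_recr//= lerDr.
by apply: sumr_ge0 => k _; apply: sqn_ge0.
Qed.

Lemma ae_countable (T : Type) (A : set T) (P : T -> D -> Prop) :
  countable A -> (forall f, A f -> {ae mu, forall x, P f x}) ->
  {ae mu, forall x, forall f, A f -> P f x}.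
Proof.
move=> /pfcard_geP[A0|[g]] h.
  by apply: nearW => x f; rewrite A0.
have : {ae mu, forall x, forall n : nat, P (g n) x}.
  by apply: ae_foralln => n; apply: h; apply: funS.
apply: filterS => x hx f Af; have [n _ <-] : (g @` setT) f by apply: surj.
exact: hx.
Qed.

Lemma sum_sqn_cvg (s : seq (D * R)) (g : nat -> D -> C) (h : D -> C) (e : R) :
  (forall xw, List.In xw s -> sqn_cvg (fun L => g L xw.1) (h xw.1) /\ 0 < xw.2) ->
  0 < e -> exists L0, forall L, (L0 <= L)%N ->
    \sum_(xw <- s) xw.2 * sqn (h xw.1 - g L xw.1) <= e.
Proof.
elim: s e => [|xw s ih] e hs e0.
  by exists 0%N => L _; rewrite big_nil ltW.
have [cv w0] := hs xw (or_introl erefl).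
have [L1 h1] := cv (e / 2 / xw.2) (divr_gt0 (divr_gt0 e0 (ltr0Sn _ _)) w0).
have [L2 h2] := ih (e / 2) (fun y ys => hs y (or_intror ys)) (divr_gt0 e0 (ltr0Sn _ _)).
exists (maxn L1 L2) => L; rewrite geq_max => /andP[/h1 a /h2 b]; rewrite big_cons.
have : xw.2 * sqn (h xw.1 - g L xw.1) <= e / 2.
  by rewrite mulrC -ler_pdivlMr.
lra.
Qed.

End Convergence.

(** * The error bounds *)

Section Alpha.
Context {R : realType} {d : measure_display} {D : measurableType d}.
Variable mu : {measure set D -> \bar R}.
Local Notation C := R[i].
Local Notation rc := (real_complex R).
Variables (F : metricType R) (ev : F -> D -> C) (G : set (D -> C))
  (nG : (D -> C) -> R) (V : nat -> set (D -> C)).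
Hypothesis H : assumptionB mu ev G nG V.
Local Notation alpha := (alpha mu ev V).
Local Notation n2 := (n2 mu).

Lemma V_le k l : (0 < k)%N -> (k <= l)%N -> V k `<=` V l.
Proof.
move=> k0 kl; rewrite -(subnKC kl); elim: (l - k)%N => [|j ih].
  by rewrite addn0.
rewrite addnS; apply: subset_trans ih _; apply: (B4_nested H).
by rewrite addn_gt0 k0.
Qed.

Lemma V_inL2 k f : (0 < k)%N -> V k f -> inL2 mu f.
Proof. by move=> k0 Vf; have [] := B4_sub H k0 Vf. Qed.

(** The point [f0] rules out the empty supremum, which would be -oo. *)
Lemma alpha_ge0 (f0 : F) k : (0 <= alpha k)%E.
Proof.
apply: (@le_trans _ _ (ereal_inf [set norm2 mu (fsub (ev f0) g) | g in V k])).
  by apply: le_ereal_inf_tmp => _ [g _ <-]; apply: Lnorm_ge0.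
by apply: ereal_sup_ubound; exists f0.
Qed.

Lemma alpha_anti k l : (0 < k)%N -> (k <= l)%N -> (alpha l <= alpha k)%E.
Proof.
move=> k0 kl; apply: ge_ereal_sup => _ [f _ <-].
apply: (@le_trans _ _ (ereal_inf [set norm2 mu (fsub (ev f) g) | g in V k])).
  apply: le_ereal_inf_tmp => _ [g Vg <-]; apply: ereal_inf_lbound.
  by exists g => //; apply: V_le Vg.
by apply: ereal_sup_ubound; exists f.
Qed.

Lemma n2_proj_alpha k b n f : (0 < k)%N -> onsys mu b n ->
  (forall g, V k g -> sq2 mu (fsub g (orthproj mu b n g)) = 0) ->
  alpha k \is a fin_num ->
  n2 (fsub (ev f) (orthproj mu b n (ev f))) <= fine (alpha k).
Proof.
move=> k0 onb cmp afin; rewrite -lee_fin (fineK afin).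
have hf := B2_L2 H f.
apply: (@le_trans _ _ (ereal_inf [set norm2 mu (fsub (ev f) g) | g in V k])).
  apply: le_ereal_inf_tmp => _ [g Vg <-]; have hg := V_inL2 k0 Vg.
  rewrite (inL2_norm2 (inL2B hf hg)).
  by rewrite lee_fin; apply: proj_best => //; apply: cmp.
by apply: ereal_sup_ubound; exists f.
Qed.

Lemma near_eval (f : F) (x : D) (e : R) : 0 < e ->
  \forall f' \near f, sqn (ev f' x - ev f x) <= e.
Proof.
move=> e0.
have cx : (fun g : F => (ev g x : R[i]^o)) @ f --> (ev f x : R[i]^o).
  exact: (@B1_eval _ _ _ _ _ _ _ _ _ H x f).
have se : 0 < rc (Num.sqrt e) by rewrite ltcR sqrtr_gt0.
have /cvgrPdist_lt/(_ _ se) := cx.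
apply: filterS => f'; rewrite distrC normc_def ltcR -/(sqn _) => h.
rewrite -(@ler_sqrt _ _ e) ?(ltW e0)//; exact: ltW.
Qed.

Lemma near_n2 (f : F) (e : R) : 0 < e ->
  \forall f' \near f, n2 (fsub (ev f') (ev f)) <= e.
Proof.
move=> e0; have := B2_continuous H f.
move=> /fine_cvgP[_ /cvgrPdist_lt/(_ _ e0)].
by apply: filterS => f' /=; rewrite sub0r normrN ger0_norm ?n2_ge0// => /ltW.
Qed.

End Alpha.

(** * The bound in the L2 norm *)

Section L2Bound.
Context {R : realType} {d : measure_display} {D : measurableType d}.
Variable mu : {measure set D -> \bar R}.
Local Notation C := R[i].
Local Notation rc := (real_complex R).
Variables (F : metricType R) (ev : F -> D -> C) (G : set (D -> C))
  (nG : (D -> C) -> R) (V : nat -> set (D -> C)).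
Hypothesis H : assumptionB mu ev G nG V.
Variable m : nat.
Hypothesis m_gt0 : (0 < m)%N.
Local Notation alpha := (alpha mu ev V).
Local Notation n2 := (n2 mu).
Local Notation sq2 := (sq2 mu).
Let a k : R := fine (alpha k).

Definition L2sum : \bar R :=
  (\sum_((m %/ 4).+1 <= k <oo) alpha k * ((Num.sqrt k%:R)^-1)%:E)%E.

Variable f0 : F.
Hypothesis L2sum_fin : (L2sum < +oo)%E.

Let term_ge0 k : (0 <= alpha k * ((Num.sqrt k%:R)^-1)%:E)%E.
Proof.
apply: mule_ge0; first exact: (alpha_ge0 mu ev V f0 k).
by rewrite lee_fin invr_ge0 sqrtr_ge0.
Qed.

(** The factor 1 / sqrt k is positive, so one infinite [alpha k] would make the whole series
    infinite. *)
Lemma alpha_fin k : (m %/ 4 < k)%N -> alpha k \is a fin_num.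
Proof.
move=> mk; rewrite ge0_fin_numE ?(alpha_ge0 mu ev V f0)// ltey; apply/eqP => ak.
suff : (L2sum = +oo)%E by move=> e; move: L2sum_fin; rewrite e ltxx.
apply/eqP; rewrite -leye_eq.
apply: le_trans (nneseries_lim_ge k.+1 _); last by move=> *; apply: term_ge0.
rewrite big_nat_recr//=.
have -> : (alpha k * ((Num.sqrt k%:R)^-1)%:E = +oo)%E.
  by rewrite ak gt0_mulye// lte_fin invr_gt0 sqrtr_gt0 ltr0n (leq_trans _ mk).
set T := (\sum_(_ <= _ < _) _)%E; have T0 : (0 <= T)%E by apply: sume_ge0.
by rewrite addey// -ltNye (lt_le_trans _ T0).
Qed.

Lemma alphar_ge0 k : 0 <= a k.
Proof. by apply: fine_ge0; apply: (alpha_ge0 mu ev V f0 _). Qed.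

Lemma alphar_anti k l : (m %/ 4 < k)%N -> (k <= l)%N -> a l <= a k.
Proof.
move=> mk kl; apply: fine_le; rewrite ?alpha_fin ?(leq_trans mk)//.
by apply: alpha_anti H _ _ _ kl; apply: leq_trans mk.
Qed.

Lemma L2sum_ge0 : (0 <= L2sum)%E.
Proof. by apply: nneseries_ge0 => *; apply: term_ge0. Qed.

Lemma L2sum_partial n :
  \sum_((m %/ 4).+1 <= k < n) a k * (Num.sqrt k%:R)^-1 <= fine L2sum.
Proof.
rewrite -lee_fin fineK ?ge0_fin_numE ?L2sum_ge0//.
apply: le_trans (nneseries_lim_ge n _); last by move=> *; apply: term_ge0.
rewrite -sumEFin le_eqVlt; apply/orP; left; apply/eqP.
rewrite big_nat [RHS]big_nat; apply: eq_bigr => k /andP[mk _].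
by rewrite EFinM /a fineK// alpha_fin.
Qed.

Lemma quarter_lt_pow2 k : (m %/ 4 < 2 ^ k * m)%N.
Proof.
apply: (@leq_trans m); first by rewrite ltn_Pdiv.
by rewrite leq_pmull// expn_gt0.
Qed.

(** Takes the place of the sum S itself: [block_weights] only asks for a number dominating its
    partial sums. *)
Definition Smax : R := 2 * fine L2sum / Num.sqrt m%:R.

(** For M = 2^l m and M/2 < k <= M one has a M <= a k and sqrt k <= sqrt M, so (sqrt M / 2) a M is
    at most M/2 times the k-th term of [L2sum], as [dyadic_sum] requires. *)
Lemma dyadic_alpha J :
  \sum_(0 <= l < J) Num.sqrt (2 ^+ l) * a (2 ^ l * m)%N <= Smax.
Proof.
have sm : 0 < Num.sqrt m%:R :> R by rewrite sqrtr_gt0 ltr0n.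
rewrite /Smax ler_pdivlMr//.
case: J => [|J]; first by rewrite big_geq// mul0r mulr_ge0// fine_ge0// L2sum_ge0.
pose g l := 2^-1 * Num.sqrt (2 ^ l * m)%:R * a (2 ^ l * m)%N.
have hg : \sum_(0 <= l < J.+1) g l <= fine L2sum.
  apply: le_trans (L2sum_partial (2 ^ J * m).+1).
  apply: dyadic_sum => // [k mk|l k k1 k2].
    by rewrite mulr_ge0 ?alphar_ge0// invr_ge0 sqrtr_ge0.
  set M := (2 ^ l * m)%N in k1 k2 *.
  have k0 : (0 < k)%N by lia.
  have M0 : (0 < M)%N by lia.
  have m4k : (m %/ 4 < k)%N.
    have : (m <= M)%N by rewrite leq_pmull// expn_gt0.
    by have := leq_trunc_div m 4; lia.
  have aMk : a M <= a k by apply: alphar_anti.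
  have sk : 0 < Num.sqrt k%:R :> R by rewrite sqrtr_gt0 ltr0n.
  have sM : 0 < Num.sqrt M%:R :> R by rewrite sqrtr_gt0 ltr0n.
  have skM : Num.sqrt k%:R <= Num.sqrt M%:R :> R by rewrite ler_sqrt ?ler_nat ?ler0n.
  have MM : M%:R = Num.sqrt M%:R ^+ 2 :> R by rewrite sqr_sqrtr.
  rewrite /g -/M.
  have -> : M%:R / 2 * (a k / Num.sqrt k%:R) =
    2^-1 * Num.sqrt M%:R * (Num.sqrt M%:R / Num.sqrt k%:R * a k).
    by rewrite {1}MM; ring.
  rewrite ler_pM2l ?mulr_gt0// ?invr_gt0//.
  apply: le_trans aMk _; rewrite ler_peMl ?alphar_ge0//.
  by rewrite ler_pdivlMr// mul1r.
have -> : (\sum_(0 <= l < J.+1) Num.sqrt (2 ^+ l) * a (2 ^ l * m)%N) * Num.sqrt m%:R =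
   2 * \sum_(0 <= l < J.+1) g l.
  rewrite mulr_suml mulr_sumr; apply: eq_bigr => l _.
  by rewrite /g natrM natrX sqrtrM ?exprn_ge0//; field.
by rewrite ler_pM2l.
Qed.

Lemma dyadic_chain : exists (b : nat -> D -> C) (r : nat -> nat), [/\
    (forall l, (r l <= r l.+1)%N), (forall l, (r l <= 2 ^ l * m)%N),
    (forall l, onsys mu b (r l)),
    (forall l k, (k < r l)%N -> V (2 ^ l * m) (b k)) &
    forall l f, V (2 ^ l * m) f -> sq2 (fsub f (orthproj mu b (r l) f)) = 0].
Proof.
have pos l : (0 < 2 ^ l * m)%N by rewrite muln_gt0 expn_gt0.
apply: (@orthonormal_chain _ _ _ mu (fun l => V (2 ^ l * m)%N) (fun l => 2 ^ l * m)%N).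
- by move=> l; apply: (B4_dim H).
- by move=> l f; apply: (V_inL2 H).
- by move=> l; apply: (V_le H) => //; rewrite leq_mul2r leq_exp2l ?leqnSn ?orbT.
Qed.

Lemma Smax_ge0 : 0 <= Smax.
Proof. by rewrite divr_ge0 ?sqrtr_ge0// mulr_ge0// fine_ge0// L2sum_ge0. Qed.

Lemma alphar_le_Smax : a m <= Smax.
Proof.
by have := dyadic_alpha 1; rewrite big_nat1 expr0 sqrtr1 mul1r expn0 mul1n.
Qed.

Lemma Smax_bound : 24 * Smax <= 70 / Num.sqrt m%:R * fine L2sum.
Proof.
have sm : 0 < (Num.sqrt m%:R)^-1 :> R by rewrite invr_gt0 sqrtr_gt0 ltr0n.
have L0 : 0 <= fine L2sum by rewrite fine_ge0// L2sum_ge0.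
rewrite /Smax; have : 0 <= (Num.sqrt m%:R)^-1 * fine L2sum by rewrite mulr_ge0// ltW.
nra.
Qed.

Lemma sampling_exists : exists (n : nat) (x : 'I_n -> D) (phi : 'I_n -> D -> C),
  [/\ n%:R <= 5 * m%:R :> R, (forall i, V m (phi i)) &
   forall f, inL2 mu (sampling_algorithm x phi (ev f)) /\
     n2 (fsub (ev f) (sampling_algorithm x phi (ev f))) <= 24 * Smax].
Proof.
have [b [r [rm rN onb Wb cmp]]] := dyadic_chain.
have hev f : inL2 mu (ev f) := B2_L2 H f.
have hp l f : inL2 mu (orthproj mu b (r l) f) by apply: inL2_comb.
have pa l f : n2 (fsub (ev f) (orthproj mu b (r l) (ev f))) <= a (2 ^ l * m)%N.
  apply: (n2_proj_alpha H) => //.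
  - by rewrite muln_gt0 expn_gt0.
  - by move=> g; apply: cmp.
  - exact/alpha_fin/quarter_lt_pow2.
have pa2 l f : sq2 (fsub (ev f) (orthproj mu b (r l) (ev f))) <= a (2 ^ l * m)%N ^+ 2.
  rewrite -n2_sqr; last exact: inL2B.
  by rewrite ler_pXn2r ?nnegrE ?n2_ge0 ?alphar_ge0.
have S0 := Smax_ge0.
(* If the first system is empty, every function of [V m] is null and the zero algorithm already has
   error at most [a m]; the lower barrier needs a matrix of positive size. *)
have [r00|r0p] := posnP (r 0%N).
  have x0 : 'I_0 -> D by case.
  exists 0%N, x0, (fun _ _ => 0); split => //.
  - by rewrite mulr_ge0.
  - by case.
  move=> f; set A := sampling_algorithm _ _ _.
  have A0 : A = fun=> 0 by apply/funext => y; rewrite /A /sampling_algorithm big_ord0.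
  split; first by rewrite A0; apply: inL20.
  have := pa 0%N f; rewrite r00.
  have -> : orthproj mu b 0 (ev f) = A.
    by rewrite A0; apply/funext => y; rewrite /orthproj /comb big_ord0.
  by move=> /le_trans; apply; rewrite expn0 mul1n; have := alphar_le_Smax; lra.
have r0m : (r 0%N <= m)%N by have := rN 0%N; rewrite expn0 mul1n.
have [tt [tt0 tt2 ttsum ttZ]] := block_weights rm rN (fun l => alphar_ge0 _) dyadic_alpha.
have [A [cA dA]] := B1_separable H.
(* The summability asked for by [ae_sqn_cvg]: as a_l <= 2^(l/2) a_l <= Smax, the square of a_l is at
   most Smax 2^(l/2) a_l. *)
have M2 f n : \sum_(0 <= l < n) sq2 (fsub (ev f) (orthproj mu b (r l) (ev f))) <= Smax ^+ 2.
  apply: (@le_trans _ _ (\sum_(0 <= l < n) Smax * (Num.sqrt (2 ^+ l) * a (2 ^ l * m)%N))).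
    apply: ler_sum => l _; apply: le_trans (pa2 l f) _.
    have al0 := alphar_ge0 (2 ^ l * m)%N.
    have s1 : 1 <= Num.sqrt (2 ^+ l) :> R.
      rewrite -[leLHS]sqrtr1 ler_sqrt ?exprn_ge0//.
      by rewrite exprn_ege1// ler1n.
    have h1 : Num.sqrt (2 ^+ l) * a (2 ^ l * m)%N <= Smax.
      apply: le_trans (dyadic_alpha l.+1); rewrite big_nat_recr//= lerDr.
      by apply: sumr_ge0 => k _; rewrite mulr_ge0 ?sqrtr_ge0 ?alphar_ge0.
    set q := Num.sqrt _ in s1 h1 *; set al := a _ in al0 h1 *.
    have h2 : al <= q * al by rewrite ler_peMl.
    have h3 : al <= Smax := le_trans h2 h1.
    by rewrite expr2; apply: ler_pM.
  by rewrite -mulr_sumr expr2 ler_wpM2l// dyadic_alpha.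
(* The null set must not depend on [f], so convergence is demanded only on the countable dense
   set. *)
pose good x := forall f, A f ->
  sqn_cvg (fun L => orthproj mu b (r L) (ev f) x) (ev f x).
have aeg : {ae mu, forall x, good x}.
  apply: (ae_countable (P := fun f x =>
    sqn_cvg (fun L => orthproj mu b (r L) (ev f) x) (ev f x))) => // f Af.
  by apply: ae_sqn_cvg (M2 f).
have [s [L0 [ss gs lo up]]] :=
  sampling_points rm onb r0p r0m tt0 tt2 ttsum aeg.
have mR : 0 < m%:R :> R by rewrite ltr0n.
have [phi [phiV rep ls]] := least_squares mR (onb 0%N) lo (fun xw h => (gs xw h).2).
exists (size s), (fun i => (tnth (in_tuple s) i).1), phi.
set alg := sampling_algorithm _ phi in rep ls *.
split; first by rewrite ss natrM.
  move=> i; have [c ->] := phiV i; apply: subspace_comb.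
    exact: has_dim_subspace (B4_dim H m_gt0).
  by move=> k kr; have := Wb 0%N k kr; rewrite expn0 mul1n.
have halg h : inL2 mu (alg h) := (ls h).1.
(* On the dense set the sampled values of [f - P f] are limits of block sums. *)
have dense_bound f : A f -> n2 (fsub (ev f) (alg (ev f))) <= 24 * Smax.
  move=> Af; set p := orthproj mu b (r 0%N) (ev f); pose h := fsub (ev f) p.
  have hin : inL2 mu h by exact: (inL2B (hev f) (hp 0%N (ev f))).
  pose c k := if (k < r 0%N)%N then 0 else ip mu (ev f) (b k).
  have r0L L : (r 0%N <= r L)%N by elim: L => // L ih; apply: leq_trans ih _.
  have combc L : comb b (r L) c = fsub (orthproj mu b (r L) (ev f)) p.
    by rewrite orthproj_sub.
  have blockc l : \sum_(r l <= k < r l.+1) sqn (c k) <= a (2 ^ l * m)%N ^+ 2.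
    apply: le_trans (pa2 l f); apply: le_trans (bessel_tail (onb l.+1) (hev f) (rm l)).
    by apply: ler_sum => k _; rewrite /c; case: ifP => // _; rewrite sqn0 sqn_ge0.
  (* Here h is P_L f - P_0 f plus f - P_L f. The first part costs 256 m Smax^2, the second is as
     small as desired on the finitely many points, and the splitting doubles the constant. *)
  have sumh : \sum_(xw <- s) xw.2 * sqn (h xw.1) <= 512 * m%:R * Smax ^+ 2.
    apply/ler_addgt0Pr => e e0.
    have e2 : 0 < e / 2 by rewrite divr_gt0.
    have [|L1 hL1] := @sum_sqn_cvg _ _ _ s (fun L => orthproj mu b (r L) (ev f)) (ev f) _ _ e2.
      by move=> xw xs; have [gx w0] := gs xw xs; split => //; apply: gx.
    pose L := maxn L0 L1.
    have u1 := up c L (leq_maxl _ _) (fun k kr => ltac:(by rewrite /c kr)).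
    have u2 := ttZ c L blockc.
    have u3 := hL1 L (leq_maxr _ _).
    have u4 : \sum_(xw <- s) xw.2 * sqn (h xw.1) <=
        2 * (\sum_(xw <- s) xw.2 * sqn (comb b (r L) c xw.1)) +
        2 * \sum_(xw <- s) xw.2 * sqn (ev f xw.1 - orthproj mu b (r L) (ev f) xw.1).
      have : forall xw, List.In xw s -> 0 < xw.2 by move=> xw /gs[].
      rewrite combc; elim: (s) => [|xw s' ih] hs.
        by rewrite !big_nil mulr0 addr0.
      have {}ih := ih (fun y ys => hs y (or_intror ys)).
      have w0 := hs xw (or_introl erefl).
      rewrite !big_cons.
      set y := orthproj mu b (r L) (ev f) xw.1 in ih *.
      have -> : h xw.1 = (fsub (orthproj mu b (r L) (ev f)) p xw.1) + (ev f xw.1 - y).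
        by rewrite /h /fsub -/y; ring.
      set y1 := fsub _ _ _; set y2 := _ - y.
      have : xw.2 * sqn (y1 + y2) <= xw.2 * (2 * sqn y1 + 2 * sqn y2).
        by rewrite ler_pM2l ?sqnD_le.
      lra.
    have u5 : 256 * m%:R * (\sum_(r 0%N <= k < r L) sqn (c k) / tt k) <=
      256 * m%:R * Smax ^+ 2 by rewrite ler_pM2l// mulr_gt0.
    lra.
  (* 23 is the least integer whose square exceeds 512. As the algorithm reproduces p, the total
     error is at most n2 h + n2 (alg h), that is (1 + 23) Smax. *)
  have algh : n2 (alg h) <= 23 * Smax.
    have S23 : 0 <= 23 * Smax by apply: mulr_ge0 => //.
    rewrite -(@ler_pXn2r _ 2)// ?nnegrE ?n2_ge0//.
    rewrite n2_sqr//; have [_ lsh] := ls h.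
    have : m%:R * sq2 (alg h) <= m%:R * (512 * Smax ^+ 2) by lra.
    rewrite ler_pM2l// => /le_trans; apply.
    have -> : (23 * Smax) ^+ 2 = 529 * Smax ^+ 2 by ring.
    by rewrite ler_wpM2r ?sqr_ge0// ler_nat.
  have algp : alg p = p by apply: rep.
  have : n2 (fsub (ev f) (alg (ev f))) <= n2 h + n2 (fsub p (alg (ev f))).
    exact: (n2_tri (hev f) (hp 0%N (ev f)) (halg (ev f))).
  rewrite (n2_subC mu p) -{1}algp -sampling_sub -/alg -/h.
  have : n2 h <= Smax.
    have := pa 0%N f; rewrite -/p -/h expn0 mul1n => /le_trans; apply.
    exact: alphar_le_Smax.
  lra.
(* Passage to all of [F]: the L2 norm and the finitely many evaluations are continuous on [F], so a
   nearby point of the dense set has nearly the same error. *)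
move=> f; split => //; apply/ler_addgt0Pr => e e0.
have e2 : 0 < e / 2 by rewrite divr_gt0.
pose eta := m%:R * (e / 2) ^+ 2.
have eta0 : 0 < eta by rewrite mulr_gt0// exprn_gt0.
have near_s : forall t : R, 0 < t -> \forall f' \near f,
    \sum_(xw <- s) xw.2 * sqn (ev f' xw.1 - ev f xw.1) <= t.
  have : forall xw, List.In xw s -> 0 < xw.2 by move=> xw /gs[].
  elim: (s) => [|xw s' ih] hs t t0.
    by apply: nearW => f'; rewrite big_nil ltW.
  have w0 := hs xw (or_introl erefl).
  have t2 : 0 < t / 2 by rewrite divr_gt0.
  apply: filterS2 (ih (fun y ys => hs y (or_intror ys)) _ t2)
    (near_eval H f xw.1 (divr_gt0 t2 w0)) => f' h1 h2.
  rewrite big_cons; move: h2; rewrite ler_pdivlMr// mulrC; lra.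
have nf : \forall f' \near f, n2 (fsub (ev f') (ev f)) <= e / 2 /\
    \sum_(xw <- s) xw.2 * sqn (ev f' xw.1 - ev f xw.1) <= eta.
  by apply: filterS2 (near_n2 H f e2) (near_s _ eta0) => f' ? ?; split.
have [|f' [Of' Af']] := dA (interior [set f' | n2 (fsub (ev f') (ev f)) <= e / 2 /\
    \sum_(xw <- s) xw.2 * sqn (ev f' xw.1 - ev f xw.1) <= eta]) _ (open_interior _).
  by exists f.
have [c1 c2] := interior_subset Of'.
have c3 : n2 (fsub (alg (ev f')) (alg (ev f))) <= e / 2.
  have e20 := ltW e2.
  rewrite -sampling_sub -(@ler_pXn2r _ 2)// ?nnegrE ?n2_ge0//.
  rewrite n2_sqr//; have [_ lsh] := ls (fsub (ev f') (ev f)).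
  by have := le_trans lsh c2; rewrite ler_pM2l.
have t1 := n2_tri (hev f) (hev f') (halg (ev f)).
have t2 := n2_tri (hev f') (halg (ev f')) (halg (ev f)).
have t3 := dense_bound f' Af'.
rewrite n2_subC in c1.
lra.
Qed.

End L2Bound.

(** * The bound in the seminorm of [G] *)

Section GBound.
Context {R : realType} {d : measure_display} {D : measurableType d}.
Variable mu : {measure set D -> \bar R}.
Local Notation C := R[i].
Local Notation rc := (real_complex R).
Variables (F : metricType R) (ev : F -> D -> C) (G : set (D -> C))
  (nG : (D -> C) -> R) (V : nat -> set (D -> C)).
Hypothesis H : assumptionB mu ev G nG V.
Local Notation alpha := (alpha mu ev V).
Local Notation Lambda := (Lambda mu nG V).
Local Notation n2 := (n2 mu).
Local Notation sq2 := (sq2 mu).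

Let sn : is_seminormed G nG := B3_seminormed H.

Lemma G_sub f g : G f -> G g -> G (fsub f g).
Proof.
have [_ GD GZ] := seminormed_subspace sn.
by move=> Gf Gg; rewrite fsubE; apply: GD => //; apply: GZ.
Qed.

Lemma nG0 : nG (fun=> 0) = 0.
Proof.
have [G0 _ _] := seminormed_subspace sn.
have := seminormZ sn 0 G0.
have -> : (fun x : D => 0 * (0 : C)) = (fun=> 0) by apply/funext => x; rewrite mul0r.
by rewrite ComplexField.Normc.normc0 mul0r.
Qed.

Lemma nG_subC f g : G f -> G g -> nG (fsub f g) = nG (fsub g f).
Proof.
move=> Gf Gg; have -> : fsub f g = fun x => (-1) * fsub g f x.
  by apply/funext => x; rewrite /fsub mulN1r opprB.
rewrite (seminormZ sn); last exact: G_sub.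
by rewrite normcN ComplexField.Normc.normc1 mul1r.
Qed.

Lemma nG_tri f g h : G f -> G g -> G h ->
  nG (fsub f h) <= nG (fsub f g) + nG (fsub g h).
Proof.
move=> Gf Gg Gh; have -> : fsub f h = fun x => fsub f g x + fsub g h x.
  by apply/funext => x; rewrite /fsub addrA subrK.
by apply: (seminormD sn); apply: G_sub.
Qed.

Lemma Lambda_ge0 k : (0 < k)%N -> (0 <= Lambda k)%E.
Proof.
move=> k0; have [b [ind VE]] := B4_dim H k0.
pose i0 : 'I_k := Ordinal k0.
have bE : b i0 = fun x => \sum_(i < k) (i == i0)%:R * b i x.
  apply/funext => x; rewrite (bigD1 i0)// eqxx mul1r big1 => [|i ii0].
    by rewrite /= addr0.
  by rewrite (negbTE ii0) mul0r.
have Vb : V k (b i0) by rewrite VE; exists (fun i => (i == i0)%:R).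
have b0 : b i0 <> fun=> 0.
  move=> b0; have := ind (fun i => (i == i0)%:R).
  have h x : \sum_(i < k) (i == i0)%:R * b i x = 0.
    by have := congr1 (@^~ x) bE; rewrite b0 => <-.
  by move=> /(_ h i0) /= /eqP; rewrite ?eqxx oner_eq0.
have [Gb _] := B4_sub H k0 Vb.
apply: (@le_trans _ _ (nG (b i0) / fine (norm2 mu (b i0)))%:E).
  by rewrite lee_fin divr_ge0 ?(n2_ge0 mu)//; apply: seminorm_ge0 sn _ Gb.
by apply: ereal_sup_ubound; exists (b i0).
Qed.

Lemma Lambda_mono k l : (0 < k)%N -> (k <= l)%N -> (Lambda k <= Lambda l)%E.
Proof.
move=> k0 kl; apply: ge_ereal_sup => _ [f [Vf f0] <-]; apply: ereal_sup_ubound.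
by exists f => //; split => //; apply: (V_le H k0 kl).
Qed.

Lemma nG_le_Lambda k g : (0 < k)%N -> Lambda k \is a fin_num -> V k g ->
  nG g <= fine (Lambda k) * n2 g.
Proof.
move=> k0 Lfin Vg; have [Gg hg] := B4_sub H k0 Vg.
have L0 : 0 <= fine (Lambda k) by apply: fine_ge0; apply: Lambda_ge0.
have [->|g0] := pselect (g = fun=> 0).
  by rewrite nG0 mulr_ge0// n2_ge0.
(* For a null function the quotient in [Lambda] carries no information; (B.3) gives it the seminorm
   of 0. *)
have [ng0|ng0] := eqVneq (n2 g) 0.
  rewrite ng0 mulr0 (B3_ae H (g := fun=> 0))// ?nG0//.
    by have [] := seminormed_subspace sn.
  by apply: sq2_ae0 => //; rewrite -n2_sqr// ng0 expr0n.
have np : 0 < n2 g by rewrite lt_def ng0 n2_ge0.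
rewrite -ler_pdivrMr// -lee_fin fineK//.
by apply: ereal_sup_ubound; exists g.
Qed.

Variable m : nat.
Hypothesis m_gt0 : (0 < m)%N.
Variable f0 : F.
Hypothesis L2sum_fin : (L2sum mu ev V m < +oo)%E.

Definition Gsum : \bar R :=
  (\sum_((m %/ 4).+1 <= k <oo) mulev (alpha k) (Lambda (4 * k)) * (k%:R^-1)%:E)%E.

Lemma mulev_ge0 (x y : \bar R) : (0 <= x)%E -> (0 <= y)%E -> (0 <= mulev x y)%E.
Proof.
by move=> x0 y0; rewrite /mulev; case: ifP => // _; apply: mule_ge0.
Qed.

Lemma Gterm_ge0 k : (m %/ 4 < k)%N ->
  (0 <= mulev (alpha k) (Lambda (4 * k)) * (k%:R^-1)%:E)%E.
Proof.
move=> mk; apply: mule_ge0; last by rewrite lee_fin invr_ge0.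
apply: mulev_ge0; first exact: (alpha_ge0 mu ev V f0 k).
by apply: Lambda_ge0; rewrite muln_gt0 (leq_ltn_trans _ mk).
Qed.

Lemma Gsum_ge0 : (0 <= Gsum)%E.
Proof. by apply: nneseries_ge0 => k mk _; apply: Gterm_ge0. Qed.

Hypothesis Gsum_fin : (Gsum < +oo)%E.
Let a k : R := fine (alpha k).
Let lam k : R := fine (Lambda k).

(** With [mulev] an infinite [Lambda] makes its term infinite even where [alpha k] is 0, so a finite
    sum forces every [Lambda] in it to be finite. *)
Lemma Lambda4_fin k : (m %/ 4 < k)%N -> Lambda (4 * k) \is a fin_num.
Proof.
move=> mk; rewrite ge0_fin_numE; last by apply: Lambda_ge0; lia.
rewrite ltey; apply/eqP => Lk.
suff : (Gsum = +oo)%E by move=> e; move: Gsum_fin; rewrite e ltxx.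
apply/eqP; rewrite -leye_eq.
apply: le_trans (nneseries_lim_ge k.+1 _); last by move=> i mi _; apply: Gterm_ge0.
rewrite big_nat_recr//=.
have -> : (mulev (alpha k) (Lambda (4 * k)) * (k%:R^-1)%:E = +oo)%E.
  rewrite /mulev Lk eqxx orbT gt0_mulye// lte_fin invr_gt0 ltr0n.
  exact: leq_trans mk.
set T := (\sum_(_ <= _ < _) _)%E.
have T0 : (0 <= T)%E.
  by rewrite /T big_nat_cond; apply: sume_ge0 => i /andP[/andP[mi _] _]; apply: Gterm_ge0.
by rewrite addey// -ltNye (lt_le_trans _ T0).
Qed.

Lemma Lambda_fin k l : (m %/ 4 < k)%N -> (0 < l)%N -> (l <= 4 * k)%N ->
  Lambda l \is a fin_num /\ lam l <= lam (4 * k)%N.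
Proof.
move=> mk l0 lk; have k4 := Lambda4_fin mk.
have h := Lambda_mono l0 lk.
have lf : Lambda l \is a fin_num.
  by rewrite ge0_fin_numE ?Lambda_ge0// (le_lt_trans h)// ltey_eq k4.
by split => //; apply: fine_le.
Qed.

Lemma lam_ge0 k : (0 < k)%N -> 0 <= lam k.
Proof. by move=> k0; apply: fine_ge0; apply: Lambda_ge0. Qed.

Lemma Gsum_partial n :
  \sum_((m %/ 4).+1 <= k < n) a k * lam (4 * k)%N / k%:R <= fine Gsum.
Proof.
rewrite -lee_fin fineK ?ge0_fin_numE ?Gsum_ge0//.
apply: le_trans (nneseries_lim_ge n _); last by move=> i mi _; apply: Gterm_ge0.
rewrite -sumEFin le_eqVlt; apply/orP; left; apply/eqP.
rewrite big_nat [RHS]big_nat; apply: eq_bigr => k /andP[mk _].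
have ak := alpha_fin f0 L2sum_fin mk.
have lk := Lambda4_fin mk.
rewrite /mulev !EFinM /a /lam !fineK//.
by move: ak lk; case: (alpha k) => // ?; case: (Lambda _).
Qed.

Let y l := a (2 ^ l * m)%N * lam (2 ^ l.+1 * m)%N.

(** The origin of the index 4k: for M = 2^l m the l-th block of [f] lies in V_(2M), and M/2 < k <= M
    gives 2M <= 4k. As [alpha] decreases and [Lambda] increases, half of [y l] is at most M/2 times
    the k-th term of [Gsum]. *)
Lemma dyadic_Lambda J : \sum_(0 <= l < J) y l <= 2 * fine Gsum.
Proof.
case: J => [|J].
  by rewrite big_geq// mulr_ge0// fine_ge0// Gsum_ge0.
have hg : \sum_(0 <= l < J.+1) 2^-1 * y l <= fine Gsum.
  apply: le_trans (Gsum_partial (2 ^ J * m).+1).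
  apply: dyadic_sum => // [k mk|l k k1 k2].
    by rewrite divr_ge0// mulr_ge0 ?(alphar_ge0 mu ev V f0)// lam_ge0//; lia.
  rewrite /y expnS; set M := (2 ^ l * m)%N in k1 k2 *; rewrite -mulnA -/M.
  have k0 : (0 < k)%N by lia.
  have M0 : (0 < M)%N by lia.
  have m4k : (m %/ 4 < k)%N.
    have : (m <= M)%N by rewrite leq_pmull// expn_gt0.
    by have := leq_trunc_div m 4; lia.
  have aMk : a M <= a k by apply: (alphar_anti H f0 L2sum_fin).
  have [|| _ lMk] := @Lambda_fin k (2 * M)%N m4k; [by lia | by lia |].
  have -> : M%:R / 2 * (a k * lam (4 * k)%N / k%:R) =
    2^-1 * (M%:R / k%:R * (a k * lam (4 * k)%N)) by ring.
  rewrite ler_pM2l ?invr_gt0//.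
  have ak0 : 0 <= a k by apply: (alphar_ge0 mu ev V f0).
  have aM0 : 0 <= a M by apply: (alphar_ge0 mu ev V f0).
  apply: (@le_trans _ _ (a k * lam (4 * k)%N)).
    by apply: ler_pM => //; apply: lam_ge0; lia.
  rewrite ler_peMl ?mulr_ge0 ?lam_ge0//; first by lia.
  by rewrite ler_pdivlMr ?ltr0n// mul1r ler_nat.
by rewrite -mulr_sumr in hg; lra.
Qed.

Lemma nG_proj (b : nat -> D -> C) (r : nat -> nat) f :
  (forall l, (r l <= r l.+1)%N) -> (forall l, onsys mu b (r l)) ->
  (forall l k, (k < r l)%N -> V (2 ^ l * m) (b k)) ->
  (forall l g, V (2 ^ l * m) g -> sq2 (fsub g (orthproj mu b (r l) g)) = 0) ->
  nG (fsub (ev f) (orthproj mu b (r 0%N) (ev f))) <= 2 * fine Gsum.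
Proof.
move=> rm onb Wb cmp.
have pos l : (0 < 2 ^ l * m)%N by rewrite muln_gt0 expn_gt0.
have hev : inL2 mu (ev f) := B2_L2 H f.
have Gev : G (ev f) := B3_contains H f.
pose u l := orthproj mu b (r l) (ev f).
have Vu l : V (2 ^ l * m) (u l).
  by apply: subspace_comb (has_dim_subspace (B4_dim H (pos l))) (Wb l).
have Gu l : G (u l) by have [] := B4_sub H (pos l) (Vu l).
have hu l : inL2 mu (u l) by have [] := B4_sub H (pos l) (Vu l).
have pa l : n2 (fsub (ev f) (u l)) <= a (2 ^ l * m)%N.
  apply: (n2_proj_alpha H) => //; first exact: cmp.
  exact/(alpha_fin f0 L2sum_fin)/quarter_lt_pow2.
have y0 l : 0 <= y l by rewrite mulr_ge0 ?(alphar_ge0 mu ev V f0)// lam_ge0.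
have step l : nG (fsub (u l.+1) (u l)) <= y l.
  have Vd : V (2 ^ l.+1 * m) (fsub (u l.+1) (u l)).
    have [_ VD VZ] := has_dim_subspace (B4_dim H (pos l.+1)).
    rewrite fsubE; apply: VD; first exact: Vu.
    by apply: VZ; apply: (V_le H (pos l)) (Vu l); rewrite leq_mul2r leq_exp2l ?leqnSn ?orbT.
  have [|Lf _] := @Lambda_fin (2 ^ l * m) (2 ^ l.+1 * m) (quarter_lt_pow2 m_gt0 l) (pos l.+1).
    by rewrite expnS; lia.
  apply: le_trans (nG_le_Lambda (pos _) Lf Vd) _.
  rewrite mulrC; apply: ler_wpM2r; first exact: lam_ge0.
  by apply: le_trans (n2_orthproj_sub (onb l.+1) hev (rm l)) _; apply: pa.
have chain p q : (p <= q)%N -> nG (fsub (u q) (u p)) <= \sum_(p <= l < q) y l.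
  move=> pq; rewrite -(subnKC pq); elim: (q - p)%N => [|j ih].
    rewrite addn0 big_geq//; have -> : fsub (u p) (u p) = fun=> 0.
      by apply/funext => x; rewrite /fsub subrr.
    by rewrite nG0.
  rewrite addnS big_nat_recr ?leq_addr//=.
  apply: le_trans (nG_tri (Gu _) (Gu (p + j)%N) (Gu p)) _.
  by rewrite addrC lerD.
have a_small e : 0 < e -> exists L, forall l, (L <= l)%N -> n2 (fsub (ev f) (u l)) <= e.
  move=> e0.
  have [L hL] := bounded_sum_tail (dyadic_alpha H m_gt0 f0 L2sum_fin) e0.
  exists L => l Ll; apply: le_trans (pa l) _; apply: le_trans (hL l.+1 (leqW Ll)).
  rewrite big_nat_recr//=.
  have al0 : 0 <= a (2 ^ l * m)%N := alphar_ge0 mu ev V f0 _.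
  have s1 : 1 <= Num.sqrt (2 ^+ l) :> R.
    rewrite -[leLHS]sqrtr1 ler_sqrt ?exprn_ge0//.
    by rewrite exprn_ege1// ler1n.
  have h2 : a (2 ^ l * m)%N <= Num.sqrt (2 ^+ l) * a (2 ^ l * m)%N by rewrite ler_peMl.
  apply: le_trans h2 _; rewrite lerDr; apply: sumr_ge0 => k _.
  by rewrite mulr_ge0 ?sqrtr_ge0 ?(alphar_ge0 mu ev V f0).
have star g : inL2 mu g -> norm_star mu nG g = (nG g + n2 g)%:E.
  by move=> hg; rewrite /norm_star inL2_norm2.
have cauchy : forall e : R, 0 < e -> exists N : nat, forall p q : nat,
    (N <= p)%N -> (N <= q)%N -> (norm_star mu nG (fsub (u p) (u q)) < e%:E)%E.
  move=> e e0; have e4 : 0 < e / 8 by rewrite divr_gt0.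
  have [L1 h1] := a_small _ e4.
  have [L2 h2] := bounded_sum_tail dyadic_Lambda e4.
  exists (maxn L1 L2) => p q; rewrite !geq_max => /andP[p1 p2] /andP[q1 q2].
  rewrite star ?lte_fin; last exact: inL2B.
  have t1 := n2_tri (hu p) hev (hu q); rewrite [n2 (fsub (u p) (ev f))]n2_subC in t1.
  have t2 := h1 p p1; have t3 := h1 q q1.
  have c k : (L2 <= k)%N -> nG (fsub (u k) (u L2)) <= e / 8.
    by move=> Lk; apply: le_trans (chain _ _ Lk) (h2 k Lk).
  have t4 := nG_tri (Gu p) (Gu L2) (Gu q).
  rewrite [nG (fsub (u L2) _)]nG_subC// in t4.
  have t5 := c p p2; have t6 := c q q2; lra.
(* The limit [g] need not be [f]. But the projections also tend to [f] in L2, so the two agree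
   almost everywhere, and (B.3) carries the seminorm over. *)
have [g [Gg hg cvg]] := B3_complete H (fun l => conj (Gu l) (hu l)) cauchy.
have near0 e : 0 < e -> exists L, forall l, (L <= l)%N ->
    nG (fsub (u l) g) <= e /\ n2 (fsub (u l) g) <= e.
  move=> e0; have /fine_cvgP[_ /cvgrPdist_lt/(_ _ e0)[L _ hL]] := cvg.
  exists L => l Ll; have := hL l Ll; rewrite /= sub0r normrN.
  have hl := inL2B (hu l) hg; rewrite star// /=.
  have n0 := n2_ge0 mu (fsub (u l) g).
  have g0 : 0 <= nG (fsub (u l) g) by apply: (seminorm_ge0 sn); apply: G_sub.
  rewrite ger0_norm ?addr_ge0// => h; split; lra.
have fg0 : n2 (fsub (ev f) g) = 0.
  apply/eqP; rewrite eq_le n2_ge0 andbT; apply/ler_addgt0Pr => e e0.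
  have e2 : 0 < e / 2 by rewrite divr_gt0.
  have [L1 h1] := a_small _ e2; have [L2 h2] := near0 _ e2.
  have := n2_tri hev (hu (maxn L1 L2)) hg.
  have := h1 _ (leq_maxl L1 L2); have [_] := h2 _ (leq_maxr L1 L2); lra.
have aefg : {ae mu, forall x, fsub (ev f) (u 0%N) x = fsub g (u 0%N) x}.
  have hfg := inL2B hev hg.
  have : sq2 (fsub (ev f) g) = 0 by rewrite -n2_sqr// fg0 expr0n.
  move=> /(sq2_ae0 hfg); apply: filterS => x; rewrite /fsub => /eqP.
  by rewrite subr_eq0 => /eqP ->.
rewrite (B3_ae H _ _ aefg); try exact: G_sub.
apply/ler_addgt0Pr => e e0; have [L hL] := near0 _ e0.
have [h1 _] := hL L (leqnn L).
have := nG_tri Gg (Gu L) (Gu 0%N); rewrite [nG (fsub g (u L))]nG_subC//.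
have := chain 0%N L (leq0n L); have := dyadic_Lambda L; lra.
Qed.

(** Af lies in [V m], so P_0 f - Af does too and costs at most Lambda_m times its L2 norm. That norm
    is at most the L2 error of the algorithm: P_0 is a contraction and fixes Af up to a null
    function. Hence the claim for any algorithm with a good L2 bound. *)
Lemma G_error (B : R) n (x : 'I_n -> D) (phi : 'I_n -> D -> C) :
  Lambda m \is a fin_num -> (forall i, V m (phi i)) ->
  (forall f, n2 (fsub (ev f) (sampling_algorithm x phi (ev f))) <= B) ->
  forall f, nG (fsub (ev f) (sampling_algorithm x phi (ev f))) <=
    2 * fine Gsum + fine (Lambda m) * B.
Proof.
move=> Lm Vphi hB f; set A := sampling_algorithm x phi (ev f).
have [b [r [rm rN onb Wb cmp]]] := dyadic_chain H m_gt0.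
have e0 : (2 ^ 0 * m = m)%N by rewrite mul1n.
have dV := B4_dim H m_gt0; have [V0 VD VZ] := has_dim_subspace dV.
have hev : inL2 mu (ev f) := B2_L2 H f.
have VA : V m A.
  rewrite /A /sampling_algorithm; elim: (index_enum _) => [|i s ih].
    by under eq_fun do rewrite big_nil.
  by under eq_fun do rewrite big_cons; apply: VD => //; apply: VZ.
have [GA hA] := B4_sub H m_gt0 VA.
set u := orthproj mu b (r 0%N) (ev f).
have Vu : V m u.
  apply: subspace_comb (has_dim_subspace dV) _ => k kr.
  by have := Wb 0%N k kr; rewrite e0.
have [Gu hu] := B4_sub H m_gt0 Vu.
have h := nG_proj f rm onb Wb cmp; rewrite -/u in h.
apply: le_trans (nG_tri (B3_contains H f) Gu GA) _.
apply: lerD h _.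
have VuA : V m (fsub u A) by rewrite fsubE; apply: VD => //; apply: VZ.
apply: le_trans (nG_le_Lambda m_gt0 Lm VuA) _.
apply: ler_wpM2l; first by apply: fine_ge0; apply: Lambda_ge0.
apply: le_trans (hB f); rewrite -/A.
pose pA := orthproj mu b (r 0%N) A.
have hpA : inL2 mu pA by apply: inL2_comb.
apply: le_trans (n2_tri hu hpA hA) _.
have -> : n2 (fsub pA A) = 0.
  rewrite n2_subC; apply: n2_eq0; first exact: inL2B.
  by apply: cmp; rewrite e0.
rewrite addr0 -orthprojB//; apply: n2_orthproj => //; exact: inL2B.
Qed.

End GBound.

(** * Void bounds, and assembly of the two estimates *)

Theorem theorem4 (R : realType) :
  exists c : R, 0 < c /\
  forall (d : measure_display) (D : measurableType d)
    (mu : {measure set D -> \bar R})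
    (F : metricType R) (ev : F -> D -> R[i])
    (G : set (D -> R[i])) (nG : (D -> R[i]) -> R)
    (V : nat -> set (D -> R[i])),
  assumptionB mu ev G nG V ->
  forall m : nat, (0 < m)%N ->
  let L2_sum : \bar R :=
    (\sum_((m %/ 4).+1 <= k <oo) alpha mu ev V k * ((Num.sqrt k%:R)^-1)%:E)%E in
  let G_sum : \bar R :=
    (\sum_((m %/ 4).+1 <= k <oo)
       mulev (alpha mu ev V k) (Lambda mu nG V (4 * k)) * (k%:R^-1)%:E)%E in
  let L2_bound (n : nat) (x : 'I_n -> D) (phi : 'I_n -> D -> R[i]) : Prop :=
    (ereal_sup [set norm2 mu (fsub (ev f) (sampling_algorithm x phi (ev f)))
               | f in [set: F]]
     <= (70 / Num.sqrt m%:R)%:E * L2_sum)%E in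
  let G_bound (n : nat) (x : 'I_n -> D) (phi : 'I_n -> D -> R[i]) : Prop :=
    (ereal_sup [set (nG (fsub (ev f) (sampling_algorithm x phi (ev f))))%:E
               | f in [set: F]]
     <= 2%:E * G_sum
        + (70 / Num.sqrt m%:R)%:E * mulev (Lambda mu nG V m) L2_sum)%E in
  (exists (n : nat) (x : 'I_n -> D) (phi : 'I_n -> D -> R[i]),
     [/\ n%:R <= c * m%:R, (forall i, V m (phi i)) & L2_bound n x phi]) /\
  (forall (n : nat) (x : 'I_n -> D) (phi : 'I_n -> D -> R[i]),
     n%:R <= c * m%:R -> (forall i, V m (phi i)) -> L2_bound n x phi ->
     G_bound n x phi).
Proof.
(* 5 m is the number of barrier steps, one point for each. *)
exists 5; split => // d D mu F ev G nG V H m m0 L2_sum G_sum L2_bound G_bound.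
have x0 : 'I_0 -> D by case.
(* The algorithm without points serves when [F] is empty, where the supremum is -oo, or when the L2
   bound is void. *)
have trivial_alg : L2_bound 0%N x0 (fun _ _ => 0) ->
    exists (n : nat) (x : 'I_n -> D) (phi : 'I_n -> D -> R[i]),
     [/\ n%:R <= 5 * m%:R :> R, (forall i, V m (phi i)) & L2_bound n x phi].
  by move=> h; exists 0%N, x0, (fun _ _ => 0); split; rewrite ?mulr_ge0//; case.
have [[f0 _]|noF] := pselect (exists f : F, True); last first.
  have nof (f : F) : False by apply: noF; exists f.
  split; first by apply: trivial_alg; apply: ge_ereal_sup => y [f _ _]; case: (nof f).
  by move=> n x phi _ _ _; apply: ge_ereal_sup => y [f _ _]; case: (nof f).
have K0 : 0 < 70 / Num.sqrt m%:R :> R by rewrite divr_gt0// sqrtr_gt0 ltr0n.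
have L20 : (0 <= L2_sum)%E := L2sum_ge0 mu ev V m f0.
have G0 : (0 <= G_sum)%E := Gsum_ge0 H m f0.
have Lm0 : (0 <= Lambda mu nG V m)%E := Lambda_ge0 H m0.
(* The summand [G_sum] is nonnegative, so it cannot cancel the +oo. *)
have mulev_void (y : \bar R) : y = +oo%E ->
    (2%:E * G_sum + (70 / Num.sqrt m%:R)%:E * y = +oo)%E.
  move=> ->; rewrite gt0_muley ?lte_fin// addey// -ltNye.
  by rewrite (lt_le_trans (ltNyr 0))// mule_ge0// lee_fin.
have [Ly|Lfin] := eqVneq L2_sum +oo%E.
  have bound_y : ((70 / Num.sqrt m%:R)%:E * L2_sum = +oo)%E.
    by rewrite Ly gt0_muley ?lte_fin.
  split; first by apply: trivial_alg; rewrite /L2_bound bound_y leey.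
  move=> n x phi _ _ _; rewrite /G_bound mulev_void ?leey//.
  by rewrite /mulev Ly eqxx orbT.
have Llt : (L2sum mu ev V m < +oo)%E by rewrite ltey.
have L2fin : L2_sum \is a fin_num by rewrite ge0_fin_numE.
split.
  have [n [x [phi [nm Vphi err]]]] := sampling_exists H m0 f0 Llt.
  exists n, x, phi; split => //; apply: ge_ereal_sup => _ [f _ <-].
  have [hA le_f] := err f.
  rewrite (inL2_norm2 (inL2B (B2_L2 H f) hA)) -(fineK L2fin) -EFinM lee_fin.
  by apply: le_trans le_f _; exact: Smax_bound.
move=> n x phi _ Vphi hL2.
have [Lmy|Lmfin] := eqVneq (Lambda mu nG V m) +oo%E.
  by rewrite /G_bound mulev_void ?leey// /mulev Lmy eqxx.
have Lmf : Lambda mu nG V m \is a fin_num by rewrite ge0_fin_numE// ltey.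
have mulevE : mulev (Lambda mu nG V m) L2_sum = (Lambda mu nG V m * L2_sum)%E.
  by rewrite /mulev (negbTE Lmfin) (negbTE Lfin).
have [Gy|Gfin] := eqVneq G_sum +oo%E.
  rewrite /G_bound Gy gt0_muley ?lte_fin// addye ?leey// -ltNye.
  rewrite (lt_le_trans (ltNyr 0))// mule_ge0// ?lee_fin ?(ltW K0)//.
  by rewrite mulevE mule_ge0.
have Glt : (Gsum mu ev nG V m < +oo)%E by rewrite ltey.
have Gf : G_sum \is a fin_num by rewrite ge0_fin_numE.
have err f : n2 mu (fsub (ev f) (sampling_algorithm x phi (ev f))) <=
    70 / Num.sqrt m%:R * fine L2_sum.
  have : (norm2 mu (fsub (ev f) (sampling_algorithm x phi (ev f))) <=
      (70 / Num.sqrt m%:R * fine L2_sum)%:E)%E.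
    rewrite EFinM (fineK L2fin); apply: le_trans hL2.
    by apply: ereal_sup_ubound; exists f.
  move=> h; rewrite -lee_fin /n2 fineK// ge0_fin_numE ?Lnorm_ge0//.
  exact: le_lt_trans h (ltry _).
apply: ge_ereal_sup => _ [f _ <-].
rewrite mulevE -(fineK L2fin) -(fineK Lmf) -(fineK Gf) -!EFinM -EFinD lee_fin.
apply: le_trans (G_error H m0 f0 Llt Glt Lmf Vphi err f) _.
by rewrite mulrCA.
Qed.
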